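(* Let $\Omega\subset\mathbb{R}^2$ be a convex polygon with $0\in\mathrm{int}\,\Omega$. Consider the time-optimal sub-Finsler problem with control $u\in\Omega$ on the Cartan group, on the Engel group, or in Martinet's case, and an extremal of it (in the sense of Pontryagin's maximum principle) with maximized Hamiltonian $H\ne0$. Let $q$ and $h_3$ be the associated quantities defined in the context. (i) If $q\neq 0$ or $h_3\ne 0$, then the optimal control $u(t)$ is a.e. piecewise-constant, and the extremal is piecewise-polynomial in $t$ of degree $3$ or less. (ii) If $q=h_3=0$, then the optimal control belongs to a fixed edge of $\Omega$, i.e. there is one edge of $\Omega$ containing $u(t)$ for a.e. $t$.
   Context: The problems. Minimize $T$ over trajectories on $[0,T]$ (with fixed end points) of one of the following control systems, with measurable control $u=(u_1,u_2)\in\Omega$: - Martinet: $\dot x_1=u_1,\ \dot x_2=u_2,\ \dot z=-\frac12x_2^2u_1$. - Engel: $\dot x_1=u_1,\ \dot x_2=u_2,\ \dot z=\frac12(x_1u_2-x_2u_1),\ \dot w=-\frac12x_2^2u_1$. - Cartan: $\dot x_1=u_1,\ \dot x_2=u_2,\ \dot z=\frac12(x_1u_2-x_2u_1),\ \dot w_1=\frac12x_1^2u_2,\ \dot w_2=-\frac12x_2^2u_1$. Pontryagin functions (with adjoint variables $p_1,p_2$ to $x_1,x_2$; in Martinet's case $q$ to $z$; on the Engel group $r$ to $z$ and $q$ to $w$; on the Cartan group $r$ to $z$ and $q_1,q_2$ to $w_1,w_2$): - Martinet: $\mathcal{H}=p_1u_1+p_2u_2-\frac q2x_2^2u_1$.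 - Engel: $\mathcal{H}=p_1u_1+p_2u_2+\frac r2(x_1u_2-x_2u_1)-\frac q2x_2^2u_1$. - Cartan: $\mathcal{H}=p_1u_1+p_2u_2+\frac r2(x_1u_2-x_2u_1)+\frac{q_1}2x_1^2u_2-\frac{q_2}2x_2^2u_1$. An extremal consists of an absolutely continuous state trajectory and an absolutely continuous, nowhere vanishing adjoint curve on $[0,T]$, together with a measurable control $u(t)\in\Omega$ (referred to as the optimal control), such that for a.e. $t$ the state equations hold, the adjoint equations hold (the derivative of each adjoint variable equals minus the partial derivative of $\mathcal{H}$ with respect to the corresponding state variable), and $u(t)$ maximizes $\mathcal{H}$ over $\Omega$. The maximum $H=\max_{u\in\Omega}\mathcal{H}$ is constant along the extremal and $H\ge0$. The quantities $q$ and $h_3$: - Martinet: $q$ is the adjoint variable to $z$ (constant in time), $h_3=qx_2$. - Engel: $q$ is the adjoint variable to $w$ (constant in time), $h_3=qx_2+r$. - Cartan: $q_1,q_2$ are constant in time, $q=\sqrt{q_1^2+q_2^2}$, $h_3=r+q_1x_1+q_2x_2$. In all three cases, if $q=0$ then $h_3$ is constant in time; $h_3=0$ (resp. $h_3\neq0$) is understood as vanishing identically (resp. not vanishing identically) along the extremal. ''A.e. piecewise-constant'' means that $[0,T]$ can be partitioned into finitely many intervals on each of which $u(t)$ equals a constant for a.e. $t$; ''piecewise-polynomial of degree $3$ or less'' means that $[0,T]$ can be partitioned into finitely many intervals on each of which the components of the extremal (state and adjoint variables) are polynomials in $t$ of degree at most $3$. *)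

(* Defs.v *)
From HB Require Import structures.
From mathcomp Require Import all_boot all_order all_algebra.
From mathcomp Require Import all_classical all_reals all_analysis.
From mathcomp Require Import measurable_realfun ring.

Set Implicit Arguments.
Unset Strict Implicit.
Unset Printing Implicit Defensive.

Import Order.TTheory GRing.Theory Num.Theory.
Import numFieldNormedType.Exports.

Local Open Scope classical_set_scope.
Local Open Scope ring_scope.

Definition dot (R : realType) (n : nat) (u v : 'rV[R]_n) : R :=
  \sum_i u 0 i * v 0 i.

Definition convex_hull (R : realType) (n m : nat) (v : 'I_m -> 'rV[R]_n) :
    set 'rV[R]_n :=
  [set x | exists w : 'I_m -> R,
    [/\ forall i, 0 <= w i, \sum_i w i = 1 & x = \sum_i w i *: v i]].

Definition convex_polygon (R : realType) (Omega : set 'rV[R]_2) : Prop :=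
  exists (m : nat) (v : 'I_m -> 'rV[R]_2), Omega = convex_hull v.

(* For a polygon with nonempty interior a supporting line meets it in a vertex
   or in an edge; the last condition excludes the vertices. *)
Definition polygon_edge (R : realType) (Omega E : set 'rV[R]_2) : Prop :=
  exists2 c : 'rV[R]_2, c != 0 &
    E = [set u | Omega u /\ forall v, Omega v -> dot c v <= dot c u]
    /\ exists a b, [/\ E a, E b & a != b].

Inductive subfinsler_case := Martinet | Engel | Cartan.

(* One less than the dimension of the state space. *)
Definition predim (P : subfinsler_case) : nat :=
  match P with Martinet => 2 | Engel => 3 | Cartan => 4 end.

Notation state_space R P := 'rV[R]_(predim P).+1.

(* Coordinates are taken in the order x1, x2, z (Martinet), x1, x2, z, w
   (Engel), x1, x2, z, w1, w2 (Cartan).  The column indices below are numerals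
   in 'I_n, all smaller than n. *)
Definition dynamics (R : realType) (P : subfinsler_case) :
    state_space R P -> 'rV[R]_2 -> state_space R P :=
  match P return state_space R P -> 'rV[R]_2 -> state_space R P with
  | Martinet => fun x u =>
      let x2 := x 0 1 in
      let u1 := u 0 0 in let u2 := u 0 1 in
      \row_(i < 3) [:: u1; u2; - (2^-1 * x2 ^+ 2 * u1)]`_i
  | Engel => fun x u =>
      let x1 := x 0 0 in let x2 := x 0 1 in
      let u1 := u 0 0 in let u2 := u 0 1 in
      \row_(i < 4) [:: u1; u2; 2^-1 * (x1 * u2 - x2 * u1);
                       - (2^-1 * x2 ^+ 2 * u1)]`_i
  | Cartan => fun x u =>
      let x1 := x 0 0 in let x2 := x 0 1 in
      let u1 := u 0 0 in let u2 := u 0 1 in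
      \row_(i < 5) [:: u1; u2; 2^-1 * (x1 * u2 - x2 * u1);
                       2^-1 * x1 ^+ 2 * u2; - (2^-1 * x2 ^+ 2 * u1)]`_i
  end.

(* The adjoint vector is listed in the order of the state coordinates:
   (p1, p2, q), (p1, p2, r, q), (p1, p2, r, q1, q2). *)
Definition pontryagin (R : realType) (P : subfinsler_case)
    (x p : state_space R P) (u : 'rV[R]_2) : R :=
  dot p (dynamics x u).

Lemma pontryagin_Martinet (R : realType) (x p : state_space R Martinet)
    (u : 'rV[R]_2) :
  let x2 := x 0 1 in let u1 := u 0 0 in let u2 := u 0 1 in
  let p1 := p 0 0 in let p2 := p 0 1 in let q := p 0 2 in
  pontryagin x p u = p1 * u1 + p2 * u2 - q / 2 * x2 ^+ 2 * u1.
Proof.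
rewrite /pontryagin /dot /= !big_ord_recl big_ord0 !mxE /=.
have -> : lift ord0 (lift ord0 ord0) = 2 :> 'I_3 by exact: val_inj.
have -> : lift ord0 ord0 = 1 :> 'I_3 by exact: val_inj.
by ring.
Qed.

Lemma pontryagin_Engel (R : realType) (x p : state_space R Engel) (u : 'rV[R]_2) :
  let x1 := x 0 0 in let x2 := x 0 1 in let u1 := u 0 0 in let u2 := u 0 1 in
  let p1 := p 0 0 in let p2 := p 0 1 in let r := p 0 2 in let q := p 0 3 in
  pontryagin x p u
  = p1 * u1 + p2 * u2 + r / 2 * (x1 * u2 - x2 * u1) - q / 2 * x2 ^+ 2 * u1.
Proof.
rewrite /pontryagin /dot /= !big_ord_recl big_ord0 !mxE /=.
have -> : lift ord0 (lift ord0 (lift ord0 ord0)) = 3 :> 'I_4 by exact: val_inj.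
have -> : lift ord0 (lift ord0 ord0) = 2 :> 'I_4 by exact: val_inj.
have -> : lift ord0 ord0 = 1 :> 'I_4 by exact: val_inj.
by ring.
Qed.

Lemma pontryagin_Cartan (R : realType) (x p : state_space R Cartan) (u : 'rV[R]_2) :
  let x1 := x 0 0 in let x2 := x 0 1 in let u1 := u 0 0 in let u2 := u 0 1 in
  let p1 := p 0 0 in let p2 := p 0 1 in let r := p 0 2 in
  let q1 := p 0 3 in let q2 := p 0 4 in
  pontryagin x p u
  = p1 * u1 + p2 * u2 + r / 2 * (x1 * u2 - x2 * u1)
    + q1 / 2 * x1 ^+ 2 * u2 - q2 / 2 * x2 ^+ 2 * u1.
Proof.
rewrite /pontryagin /dot /= !big_ord_recl big_ord0 !mxE /=.
have -> : lift ord0 (lift ord0 (lift ord0 (lift ord0 ord0))) = 4 :> 'I_5 by exact: val_inj.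
have -> : lift ord0 (lift ord0 (lift ord0 ord0)) = 3 :> 'I_5 by exact: val_inj.
have -> : lift ord0 (lift ord0 ord0) = 2 :> 'I_5 by exact: val_inj.
have -> : lift ord0 ord0 = 1 :> 'I_5 by exact: val_inj.
by ring.
Qed.

(* By compactness of Omega this supremum is a maximum. *)
Definition max_hamiltonian (R : realType) (P : subfinsler_case)
    (Omega : set 'rV[R]_2) (x p : state_space R P) : R :=
  sup [set pontryagin x p v | v in Omega].

Definition adjoint_q (R : realType) (P : subfinsler_case) : state_space R P -> R :=
  match P return state_space R P -> R with
  | Martinet => fun p => p 0 2
  | Engel => fun p => p 0 3
  | Cartan => fun p => Num.sqrt ((p 0 3) ^+ 2 + (p 0 4) ^+ 2)
  end.

Definition h3 (R : realType) (P : subfinsler_case) :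
    state_space R P -> state_space R P -> R :=
  match P return state_space R P -> state_space R P -> R with
  | Martinet => fun x p => p 0 2 * x 0 1
  | Engel => fun x p => p 0 3 * x 0 1 + p 0 2
  | Cartan => fun x p => p 0 2 + p 0 3 * x 0 0 + p 0 4 * x 0 1
  end.

Definition absolutely_continuous_on (R : realType) (V : normedModType R)
    (a b : R) (f : R -> V) : Prop :=
  forall e : R, 0 < e -> exists2 d : R, 0 < d &
    forall (n : nat) (s t : 'I_n -> R),
      (forall i, a <= s i /\ s i <= t i /\ t i <= b) ->
      (forall i j, i != j -> t i <= s j \/ t j <= s i) ->
      \sum_i (t i - s i) < d ->
      \sum_i `|f (t i) - f (s i)| < e.

(* The default sigma-algebra on R is the Borel one; its completion consists of
   the Lebesgue measurable sets. *)
Definition lebesgue_measurable_fun_on (R : realType) (a b : R) (f : R -> R) :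
    Prop :=
  forall B : set R, measurable B ->
    (completed_algebra_gen (@lebesgue_measure R)).-sigma.-measurable
      (`[a, b] `&` f @^-1` B).

(* Outside [0, T] the functions x, p and u are unconstrained; two-sided
   derivatives are harmless since the end points are negligible. *)
Record extremal (R : realType) (P : subfinsler_case) (Omega : set 'rV[R]_2)
    (T : R) (x p : R -> state_space R P) (u : R -> 'rV[R]_2) : Prop := Extremal {
  extremal_state_ac : absolutely_continuous_on 0 T x ;
  extremal_adjoint_ac : absolutely_continuous_on 0 T p ;
  extremal_adjoint_neq0 : forall t, t \in `[0, T] -> p t != 0 ;
  extremal_control_measurable :
    forall j, lebesgue_measurable_fun_on 0 T (fun t => u t 0 j) ;
  extremal_control_in : forall t, t \in `[0, T] -> Omega (u t) ;
  extremal_state_eq : {ae @lebesgue_measure R, forall t, t \in `[0, T] ->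
    is_derive t 1 x (dynamics (x t) (u t))} ;
  extremal_adjoint_eq : {ae @lebesgue_measure R, forall t, t \in `[0, T] ->
    is_derive t 1 p
      (- \row_i 'D_(delta_mx 0 i) (fun y => pontryagin y (p t) (u t)) (x t))} ;
  extremal_max : {ae @lebesgue_measure R, forall t, t \in `[0, T] ->
    forall v, Omega v ->
      pontryagin (x t) (p t) v <= pontryagin (x t) (p t) (u t)}
}.

Definition vanishes_on (R : realType) (T : R) (f : R -> R) : Prop :=
  forall t, t \in `[0, T] -> f t = 0.

Definition ae_piecewise_constant (R : realType) (V : Type) (T : R)
    (u : R -> V) : Prop :=
  exists2 s : seq R, itv_partition 0 T s &
    forall i, (i < size s)%N -> exists c : V,
      {ae @lebesgue_measure R,
        forall t, t \in `[nth 0 (0 :: s) i, nth 0 s i] -> u t = c}.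

(* Recall that size q = degree q + 1 for q != 0. *)
Definition piecewise_polynomial_deg_le (R : realType) (n d : nat) (T : R)
    (x : R -> 'rV[R]_n) : Prop :=
  exists2 s : seq R, itv_partition 0 T s &
    forall i, (i < size s)%N -> forall j, exists2 q : {poly R},
      (size q <= d.+1)%N &
      forall t, t \in `[nth 0 (0 :: s) i, nth 0 s i] -> x t 0 j = q.[t].

(* Main.v *)
Require Import Defs.
From mathcomp Require Import all_boot all_order all_algebra.
From mathcomp Require Import all_classical all_reals all_analysis.
From mathcomp Require Import measurable_realfun ring lra.
Set Implicit Arguments.
Unset Strict Implicit.
Unset Printing Implicit Defensive.
Import Order.TTheory GRing.Theory Num.Theory.
Import numFieldNormedType.Exports.
Local Open Scope classical_set_scope.
Local Open Scope ring_scope.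

(** Write J for the quarter turn.  In the three problems the Pontryagin
function is <h, u> for a plane covector h depending on the state and on the
adjoint variables, and along an extremal
<<
   h' = h3 J u,     h3' = <b, u>,     u in the face of Omega exposed by h,
>>
with b a constant vector, b = (0, q) in the first two problems and
b = (q1, q2) on the Cartan group.  Everything except the degree of the pieces
is a statement about such a flow ([rotation_flow], [extremal_flow]).

There are two first integrals: the support function H of Omega at h, whose
derivative is <h', u> = h3 <J u, u> = 0 ([support_flow_constant]), and
h3^2/2 - <J b, h> ([energy_flow_constant]).  As 0 is interior to Omega, H is
positive as soon as it is nonzero, and then h never vanishes.

If b = 0 and h3 = 0 then h is constant, so u stays in one exposed face of
Omega.  Such a face is an edge or a vertex, and a vertex lies on an edge: turn
the supporting line about it until it meets another vertex ([face_in_edge]).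

If b or h3 does not vanish, the point is that u is almost everywhere constant
on a one-sided neighbourhood of every time t0 ([right_constancy]; the left-hand
case follows by reversing time, which replaces h3 by - h3).  Near t0 the
control stays in the face exposed by h(t0), on which <h(t0), u> = H.  Hence
y = <J h(t0), h> satisfies y' = H h3 with y(t0) = 0, and on each side y > 0,
y < 0 the maximum condition leaves a single point of that face
([face_same_side]).  So y, h3 behave like a pendulum pushed by a force which
depends only on the sign of y.  If h3(t0) <> 0, the sign of y is fixed at once.
If h3(t0) = 0, the energy integral reads H h3^2/2 = y <b, u>, which excludes
any return to rest: y h3 >= 0, and y^2 is nondecreasing ([rest_outward]).
Either y keeps a sign right after t0, or it vanishes on an interval; then
h3 = 0 and <b, u> = 0 there, and with <h(t0), u> = H this determines u because
b <> 0 ([stationary_constant]).  Compactness, in the form of an induction on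
the interval [0, T], turns local constancy into finitely many pieces
([piecewise_constant_of_local]).  On a piece the coordinates x1, x2 are affine
in t and the other ones are primitives of quadratic polynomials in x1, x2.

Differential equations that hold almost everywhere are exploited through one
tool: an absolutely continuous function with nonnegative lower right derivative
almost everywhere is nondecreasing ([ac_nondecreasing]). *)

(** * Absolutely continuous functions *)

(** The infimum of the counterexamples satisfies [P] by the third premise, and
then the second one rules out counterexamples right after it. *)
Lemma real_induction (R : realType) (a b : R) (P : R -> Prop) :
  P a ->
  (forall c, a <= c -> c < b -> P c ->
    exists2 d, c < d & forall s, c < s -> s < d -> s <= b -> P s) ->
  (forall c, a < c -> c <= b -> (forall s, a <= s -> s < c -> P s) -> P c) ->
  forall t, a <= t -> t <= b -> P t.
Proof.
move=> Pa Pr Pl t0 at0 t0b; apply: contrapT => nPt0.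
pose S := [set t | [/\ a <= t, t <= b & ~ P t]].
have S0 : S !=set0 by exists t0.
have lS : has_lbound S by exists a => t [].
have hS : has_inf S by [].
have ac : a <= inf S by apply: lb_le_inf => // t [].
have cb : inf S <= b by apply: (le_trans _ t0b); exact: ge_inf.
have Pc : forall s, a <= s -> s < inf S -> P s.
  move=> s as_ sc; apply: contrapT => nPs.
  have : inf S <= s by apply: ge_inf => //; split=> //; lra.
  by rewrite leNgt sc.
have PS : P (inf S).
  by move: ac; rewrite le_eqVlt => /predU1P[<-//|ac]; exact: Pl.
move: cb; rewrite le_eqVlt => /predU1P[cb|cb].
  have : inf S <= t0 by exact: ge_inf.
  by move=> ct0; apply: nPt0; rewrite (_ : t0 = inf S) //; lra.
have [d cd Pd] := Pr _ ac cb PS.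
suff : d <= inf S by rewrite leNgt cd.
apply: lb_le_inf => // t [aT tb nPt].
have ct : inf S <= t by exact: ge_inf.
rewrite leNgt; apply/negP => td; apply: nPt.
move: ct; rewrite le_eqVlt => /predU1P[<-//|ct]; exact: Pd.
Qed.

(** The common source of the closure properties below under sums, products and
Lipschitz images. *)
Lemma ac_dominated2 (R : realType) (V W W' : normedModType R) (a b K L : R)
    (f : R -> V) (g : R -> W) (h : R -> W') :
  absolutely_continuous_on a b g -> absolutely_continuous_on a b h ->
  0 <= K -> 0 <= L ->
  (forall s t, a <= s -> s <= t -> t <= b ->
    `|f t - f s| <= K * `|g t - g s| + L * `|h t - h s|) ->
  absolutely_continuous_on a b f.
Proof.
move=> acg ach K0 L0 fgh e e0.
have KL0 : 0 < K + L + 1 by rewrite ltr_wpDl // addr_ge0.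
have e'0 : 0 < e / 2 / (K + L + 1) by rewrite !divr_gt0.
have [d d0 dg] := acg _ e'0; have [d' d'0 dh] := ach _ e'0.
exists (Num.min d d'); first by rewrite lt_min d0.
move=> n s t st disj; rewrite lt_min => /andP[sd sd'].
have := dg n s t st disj sd; have := dh n s t st disj sd'.
rewrite !ltr_pdivlMr //.
set Sg := \sum_i _; set Sh := \sum_i _ => hh hg.
apply: (@le_lt_trans _ _ (K * Sh + L * Sg)).
  rewrite /Sg /Sh !mulr_sumr -big_split /=; apply: ler_sum => i _.
  by have [? [? ?]] := st i; apply: fgh.
have Sg0 : 0 <= Sg by apply: sumr_ge0.
have Sh0 : 0 <= Sh by apply: sumr_ge0.
nra.
Qed.

Lemma ac_dominated (R : realType) (V W : normedModType R) (a b K : R)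
    (f : R -> V) (g : R -> W) :
  absolutely_continuous_on a b g -> 0 <= K ->
  (forall s t, a <= s -> s <= t -> t <= b ->
    `|f t - f s| <= K * `|g t - g s|) ->
  absolutely_continuous_on a b f.
Proof.
move=> acg K0 fg; apply: (ac_dominated2 acg acg K0 (lexx 0)) => s t *.
by rewrite mul0r addr0; exact: fg.
Qed.

Lemma ac_sub (R : realType) (V : normedModType R) (a b c d : R) (f : R -> V) :
  a <= c -> d <= b ->
  absolutely_continuous_on a b f -> absolutely_continuous_on c d f.
Proof.
move=> ac db acf e e0; have [dl d0 h] := acf e e0.
exists dl => // n s t st; apply: h => i; have [h1 [h2 h3]] := st i.
by split; [exact: le_trans h1|split=> //; exact: le_trans db].
Qed.

Lemma ac_add (R : realType) (V : normedModType R) (a b : R) (f g : R -> V) :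
  absolutely_continuous_on a b f -> absolutely_continuous_on a b g ->
  absolutely_continuous_on a b (fun t => f t + g t).
Proof.
move=> acf acg; apply: (ac_dominated2 acf acg ler01 ler01) => s t _ _ _.
by rewrite !mul1r opprD addrACA; exact: ler_normD.
Qed.

Lemma ac_opp (R : realType) (V : normedModType R) (a b : R) (f : R -> V) :
  absolutely_continuous_on a b f ->
  absolutely_continuous_on a b (fun t => - f t).
Proof.
move=> acf; apply: (ac_dominated acf ler01) => s t _ _ _.
by rewrite mul1r -opprD normrN.
Qed.

Lemma ac_cst (R : realType) (V : normedModType R) (a b : R) (c : V) :
  absolutely_continuous_on a b (fun=> c).
Proof.
move=> e e0; exists 1 => // n s t _ _ _.
by rewrite big1 // => i _; rewrite subrr normr0.
Qed.

Lemma ac_id (R : realType) (a b : R) : absolutely_continuous_on a b (@id R).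
Proof.
move=> e e0; exists e => // n s t st _; congr (_ < _); apply: eq_bigr => i _.
by have [_ [? _]] := st i; rewrite ger0_norm // subr_ge0.
Qed.

Lemma ac_dist (R : realType) (V : normedModType R) (a b : R) (f : R -> V) :
  absolutely_continuous_on a b f -> forall e, 0 < e -> exists2 d, 0 < d &
  forall s t, a <= s -> s <= b -> a <= t -> t <= b -> `|t - s| < d ->
    `|f t - f s| < e.
Proof.
move=> acf e e0; have [d d0 h] := acf e e0; exists d => //.
suff H : forall s t, a <= s -> s <= t -> t <= b -> `|t - s| < d ->
    `|f t - f s| < e.
  move=> s t as_ sb at_ tb std; have [st|/ltW ts] := leP s t; first exact: H.
  by rewrite distrC H // distrC.
move=> s t as_ st tb std.
have := h 1%N (fun=> s) (fun=> t) (fun=> conj as_ (conj st tb)).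
rewrite !big_ord_recl !big_ord0 !addr0; apply.
- by move=> i j; rewrite !ord1.
- by rewrite (le_lt_trans (ler_norm _)).
Qed.

Lemma ac_continuous (R : realType) (a b : R) (f : R -> R) :
  absolutely_continuous_on a b f -> {within `[a, b], continuous f}.
Proof.
move=> acf; apply/subspace_continuousP => x; rewrite /= in_itv /= => /andP[ax xb].
apply/cvgrPdist_lt => e e0; have [d d0 h] := ac_dist acf e0.
rewrite near_withinE; apply: filterS (nbhsx_ballx x d d0) => s xs /=.
by rewrite in_itv /= => /andP[as_ sb]; exact: h.
Qed.

Lemma ac_bounded (R : realType) (a b : R) (f : R -> R) :
  absolutely_continuous_on a b f ->
  exists2 M, 0 <= M & forall t, a <= t -> t <= b -> `|f t| <= M.
Proof.
move=> acf; have [ab|ba] := leP a b; last first.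
  by exists 0 => // t at_ tb; lra.
have acn : absolutely_continuous_on a b (fun t => `|f t|).
  apply: (ac_dominated acf ler01) => // s t _ _ _.
  by rewrite mul1r; exact: ler_dist_dist.
have [c _ cM] := EVT_max ab (ac_continuous acn).
by exists `|f c| => // t at_ tb; apply: cM; rewrite in_itv /= at_.
Qed.

Lemma ac_mul (R : realType) (a b : R) (f g : R -> R) :
  absolutely_continuous_on a b f -> absolutely_continuous_on a b g ->
  absolutely_continuous_on a b (fun t => f t * g t).
Proof.
move=> acf acg.
have [M M0 fM] := ac_bounded acf; have [N N0 gN] := ac_bounded acg.
apply: (ac_dominated2 acf acg N0 M0) => s t as_ st tb.
have -> : f t * g t - f s * g s = g t * (f t - f s) + f s * (g t - g s) by ring.
rewrite (le_trans (ler_normD _ _)) // !normrM lerD // ler_wpM2r //.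
  by apply: gN => //; exact: le_trans st.
by apply: fM => //; exact: le_trans tb.
Qed.

Lemma ac_reflect (R : realType) (V : normedModType R) (T : R) (f : R -> V) :
  absolutely_continuous_on 0 T f ->
  absolutely_continuous_on 0 T (fun t => f (T - t)).
Proof.
move=> acf e e0; have [d d0 h] := acf e e0; exists d => // n s t st disj sd.
under eq_bigr => i _ do rewrite distrC.
apply: (h n (fun i => T - t i) (fun i => T - s i)).
- by move=> i; have [? [? ?]] := st i; lra.
- by move=> i j /disj [?|?]; [right|left]; lra.
- by rewrite (eq_bigr (fun i => t i - s i)) // => i _; ring.
Qed.

Lemma is_derive_dist (R : realType) (f : R -> R) (t l : R) :
  is_derive t 1 f l -> forall e, 0 < e -> exists2 d, 0 < d &
    forall s, `|s - t| < d -> `|f s - f t - l * (s - t)| <= e * `|s - t|.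
Proof.
move=> [df <-] e e0.
have := df => /cvg_ex [/= l' hl].
have <- : l' = 'D_1 f t by apply/esym; apply: cvg_lim.
move/cvgrPdist_le : hl => /(_ _ e0) [d /= d0 h].
exists d => // s; have [->|st] := eqVneq s t.
  by rewrite !subrr mulr0 subr0 normr0 mulr0.
move=> sd; have := h (s - t).
rewrite /= sub0r normrN scaler1 subrK => /(_ sd).
have st0 : s - t != 0 by rewrite subr_eq0.
move=> /(_ st0) {}h.
have -> : f s - f t - l' * (s - t) = - (l' - (s - t)^-1 *: (f s - f t)) * (s - t).
  by rewrite /GRing.scale /=; field.
by rewrite normrM normrN ler_wpM2r.
Qed.

Lemma is_derive_reflect (R : realType) (f : R -> R) (c t l : R) :
  is_derive (c - t) 1 f l -> is_derive t 1 (fun s => f (c - s)) (- l).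
Proof.
move=> df; have dg : is_derive t 1 (fun s : R => c - s) (-1).
  by apply: is_derive_eq; rewrite add0r mul1r.
by have := @is_derive1_comp R f (fun s => c - s) t l (-1) df dg; rewrite mulrN1.
Qed.

Lemma is_derive_locally0 (R : realType) (f : R -> R) (a b t l : R) :
  a < t -> t < b -> (forall s, a < s -> s < b -> f s = 0) ->
  is_derive t 1 f l -> l = 0.
Proof.
move=> at_ tb f0 df; apply/eqP; rewrite -normr_le0; apply/ler_addgt0Pl => e e0.
rewrite addr0; have [d d0 hd] := is_derive_dist df e0.
have [s [ts sb sd]] : exists s, [/\ t < s, s < b & s < t + d].
  have [?|?] := leP (t + d / 2) ((t + b) / 2);
    [exists (t + d / 2)|exists ((t + b) / 2)]; split; lra.
have := hd s; rewrite (@gtr0_norm _ (s - t)) ?subr_gt0 //.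
have -> : s - t < d by lra.
move=> /(_ isT); rewrite !f0 ?(lt_trans at_ ts) // subrr sub0r normrN normrM.
by rewrite (@gtr0_norm _ (s - t)) ?subr_gt0 // ler_pM2r // subr_gt0.
Qed.

(** * Lebesgue null sets *)

Lemma lebesgue_aeS (R : realType) (P Q : R -> Prop) :
  (forall t, P t -> Q t) ->
  {ae @lebesgue_measure R, forall t, P t} ->
  {ae @lebesgue_measure R, forall t, Q t}.
Proof.
have F : Filter (almost_everywhere (@lebesgue_measure R)).
  exact: ae_filter_ringOfSetsType.
by move=> PQ; apply: (@filterS _ _ F).
Qed.

Lemma lebesgue_aeS2 (R : realType) (P P' Q : R -> Prop) :
  (forall t, P t -> P' t -> Q t) ->
  {ae @lebesgue_measure R, forall t, P t} ->
  {ae @lebesgue_measure R, forall t, P' t} ->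
  {ae @lebesgue_measure R, forall t, Q t}.
Proof.
have F : Filter (almost_everywhere (@lebesgue_measure R)).
  exact: ae_filter_ringOfSetsType.
by move=> PQ; apply: (@filterS2 _ _ F).
Qed.

(** Outer regularity at a null set. *)
Lemma null_set_open_cover (R : realType) (N : set R) (e : R) :
  (@lebesgue_measure R).-negligible N -> 0 < e ->
  exists U : set R, [/\ open U, N `<=` U & (lebesgue_measure U < e%:E)%E].
Proof.
move=> [A [mA A0 NA]] e0.
have [|U [oU AU Ue]] := lebesgue_regularity_outer mA _ e0.
  by rewrite [X in (X < _)%E](_ : _ = 0%E) ?ltry.
exists U; split => //; first exact: subset_trans AU.
have mU : measurable U by exact: open_measurable.
rewrite -(setDUK AU) measureU //; last 2 first.
  exact: measurableD.
  by rewrite setIC setDKI.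
by rewrite [X in (X + _)%E](_ : _ = 0%E) ?add0e.
Qed.

Lemma ae_exceptional_set (R : realType) (P : R -> Prop) :
  {ae @lebesgue_measure R, forall t, P t} ->
  exists2 N, (@lebesgue_measure R).-negligible N & forall t, ~ N t -> P t.
Proof. by move=> h; exists (~` [set t | P t]) => // t /contrapT. Qed.

(** Only a lower bound on the right derivative is assumed, because the
support function along a flow is not known beforehand to be differentiable.
The times at which the bound fails are covered by an open set [U] of small
measure.  Moving from [a] to [b], the loss of [f] over a step that starts at
another time is at most proportional to its length, and steps inside [U] are
paid for by the variation of [f] over disjoint intervals of small total
length, which absolute continuity makes small. *)
Lemma ac_nondecreasing (R : realType) (a b : R) (f : R -> R) :
  a <= b -> absolutely_continuous_on a b f ->
  {ae @lebesgue_measure R, forall t, a < t -> t < b ->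
    forall e, 0 < e -> exists2 d, 0 < d &
      forall s, t < s -> s < t + d -> s <= b -> f t - e * (s - t) <= f s} ->
  f a <= f b.
Proof.
move=> ab acf /ae_exceptional_set[N0 N00 dini0].
pose N := N0 `|` [set a].
have nN : (@lebesgue_measure R).-negligible N.
  apply: negligibleU => //; apply/negligibleP => //.
  exact: lebesgue_measure_set1.
have dini : forall t, ~ N t -> a <= t -> t < b ->
    forall e, 0 < e -> exists2 d, 0 < d &
      forall s, t < s -> s < t + d -> s <= b -> f t - e * (s - t) <= f s.
  move=> t Nt at_ tb; apply: dini0 => //; first by move=> ?; apply: Nt; left.
  by rewrite lt_neqAle at_ andbT eq_sym; apply/eqP => ta; apply: Nt; right.
rewrite -subr_ge0 -oppr_le0 opprB; apply/ler_addgt0Pl => e e0; rewrite addr0.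
(* Two units of [e'] cover the variation inside [U] and the slack [eta], and
   [e'] is the loss allowed per unit of time. *)
pose e' := e / (b - a + 2).
have ba2 : 0 < b - a + 2 by lra.
have e'0 : 0 < e' by rewrite divr_gt0.
have [dl dl0 vardl] := acf e' e'0.
have [U [oU NU Udl]] := null_set_open_cover nN dl0.
have mU : measurable U by exact: open_measurable.
(* [covered s n l r]: disjoint intervals inside [a, s], no longer in total than
   the part of [U] visited before [s]. *)
pose covered s n (l r : nat -> R) :=
  [/\ forall i, (i < n)%N -> a <= l i /\ l i <= r i /\ r i <= s,
   forall i j, (i < n)%N -> (j < n)%N -> i != j -> r i <= l j \/ r j <= l i &
   ((\sum_(i < n) (r i - l i))%:E <= lebesgue_measure (U `&` `]a, s]))%E].
(* The slack [eta] makes [P] stable under limits from the left. *)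
pose P s := forall eta, 0 < eta -> exists n l r, covered s n l r /\
  f a - f s <= e' * (s - a) + \sum_(i < n) `|f (r i) - f (l i)| + eta.
(* A step inside [U] is appended to the family of intervals. *)
have Pext c s : a <= c -> c < s -> s <= b -> P c -> [set x | c <= x <= s] `<=` U -> P s.
  move=> ac cs sb Pc csU eta eta0; have [n [l [r [[h1 h2 h3] h4]]]] := Pc eta eta0.
  exists n.+1, (fun i => if (i < n)%N then l i else c),
    (fun i => if (i < n)%N then r i else s); split.
    split.
    - move=> i _; have [iN|_] := ltnP i n.
        by have [? [? ?]] := h1 _ iN; do !split => //; lra.
      by do !split => //; lra.
    - move=> i j; rewrite !ltnS => iN jN.
      have [ilt|ige] := ltnP i n; have [jlt|jge] := ltnP j n => ij.
      + exact: h2.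
      + by have [? [? ?]] := h1 _ ilt; left.
      + by have [? [? ?]] := h1 _ jlt; right.
      + case/eqP: ij; apply/eqP.
        by rewrite eqn_leq (leq_trans iN jge) (leq_trans jN ige).
    - rewrite big_ord_recr /= ltnn.
      under eq_bigr => i _ do rewrite ltn_ord.
      rewrite EFinD.
      apply: (@le_trans _ _ (lebesgue_measure ((U `&` `]a, c]) `|` `]c, s]%classic))).
        rewrite measureU //=.
        + apply: leeD => //; rewrite lebesgue_measure_itv /= lte_fin cs.
          by rewrite -EFinD.
        + exact: measurableI.
        + rewrite -subset0 => x [[_ /=]]; rewrite !in_itv /= => /andP[_ xc] /andP[cx _].
          by lra.
      apply: le_measure; rewrite ?inE //.
      + by apply: measurableU => //; exact: measurableI.
      + exact: measurableI.
      + move=> x [[Ux]|] /=; rewrite in_itv /= => /andP[? ?].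
          by split => //=; rewrite in_itv /=; lra.
        by split; [apply: csU => /=|rewrite /= in_itv /=]; lra.
  rewrite big_ord_recr /= ltnn.
  under eq_bigr => i _ do rewrite ltn_ord.
  have := ler_norm (f c - f s); rewrite distrC => h5.
  have : 0 <= e' * (s - c) by rewrite mulr_ge0 //; lra.
  nra.
have : P b.
  apply: (@real_induction _ a b P) => //.
  - move=> eta eta0; exists 0%N, (fun=> 0), (fun=> 0); split.
      by split => //; rewrite big_ord0.
    by rewrite big_ord0; lra.
  - move=> c ac cb Pc; have [Uc|nUc] := pselect (U c).
      have /nbhs_ballP[d /= d0 dU] := open_nbhs_nbhs (conj oU Uc).
      exists (c + d); first lra.
      move=> s cs scd sb; apply: (Pext c) => //= x /= /andP[cx xs].
      by apply: dU; rewrite /ball /= ltr_norml; lra.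
    have [|d d0 hd] := dini c _ ac cb e' e'0; first by move=> /NU.
    exists (c + d); first lra.
    move=> s cs scd sb eta eta0; have [n [l [r [[h1 h2 h3] h4]]]] := Pc eta eta0.
    exists n, l, r; split.
      split => //.
        by move=> i /h1 [? [? ?]]; do !split => //; lra.
      apply: (le_trans h3); apply: le_measure; rewrite ?inE //; try exact: measurableI.
      apply: setIS => x /=; rewrite !in_itv /=; lra.
    have := hd s cs scd sb; nra.
  - move=> c ac cb Pc; have [Uc|nUc] := pselect (U c).
      have /nbhs_ballP[d /= d0 dU] := open_nbhs_nbhs (conj oU Uc).
      have [s [as_ sc sd]] : exists s, [/\ a <= s, s < c & c < s + d].
        by have [?|?] := leP a (c - d / 2); [exists (c - d / 2)|exists a]; split; lra.
      apply: (Pext s) => //; first exact: Pc.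
      by move=> x /= /andP[cx xs]; apply: dU; rewrite /ball /= ltr_norml; lra.
    move=> eta eta0.
    have [d d0 hd] := ac_dist acf (divr_gt0 eta0 (ltr0Sn R 1)).
    have [s [as_ sc sd]] : exists s, [/\ a <= s, s < c & c < s + d].
      by have [?|?] := leP a (c - d / 2); [exists (c - d / 2)|exists a]; split; lra.
    have [n [l [r [[h1 h2 h3] h4]]]] := Pc s as_ sc _ (divr_gt0 eta0 (ltr0Sn R 1)).
    exists n, l, r; split.
      split => //.
        by move=> i /h1 [? [? ?]]; do !split => //; lra.
      apply: (le_trans h3); apply: le_measure; rewrite ?inE //; try exact: measurableI.
      apply: setIS => x /=; rewrite !in_itv /=; lra.
    have : `|f c - f s| < eta / 2.
      by apply: hd; rewrite ?ltr_norml; lra.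
    rewrite ltr_norml => /andP[? ?].
    have : e' * (s - a) <= e' * (c - a) by rewrite ler_wpM2l //; lra.
    lra.
move=> /(_ e' e'0) [n [l [r [[h1 h2 h3] h4]]]].
have : \sum_(i < n) `|f (r i) - f (l i)| < e'.
  apply: vardl.
  - by move=> i; apply: h1.
  - by move=> i j ij; apply: h2.
  - rewrite -lte_fin; apply: (le_lt_trans h3); apply: le_lt_trans Udl.
    by apply: le_measure; rewrite ?inE //; exact: measurableI.
have -> : e = e' * (b - a + 2) by rewrite /e' divfK ?gt_eqF.
lra.
Qed.

Lemma ac_nondecreasing_deriv (R : realType) (a b : R) (f : R -> R) :
  absolutely_continuous_on a b f ->
  {ae @lebesgue_measure R, forall t, a < t -> t < b ->
    exists2 l, 0 <= l & is_derive t 1 f l} ->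
  forall s t, a <= s -> s <= t -> t <= b -> f s <= f t.
Proof.
move=> acf df s t as_ st tb; apply: ac_nondecreasing => //.
  exact: (ac_sub as_ tb).
move: df; apply: lebesgue_aeS => r dr sr rt e e0.
have [||l l0 fl] := dr; [lra|lra|].
have [d d0 hd] := is_derive_dist fl e0.
exists d => // x rx xd _.
have := hd x; rewrite (@gtr0_norm _ (x - r)) ?subr_gt0 //.
have -> : x - r < d by lra.
by move=> /(_ isT); rewrite ler_norml => /andP[+ _]; nra.
Qed.

Lemma ac_constant (R : realType) (a b : R) (f : R -> R) :
  absolutely_continuous_on a b f ->
  {ae @lebesgue_measure R, forall t, a < t -> t < b -> is_derive t 1 f 0} ->
  forall t, a <= t -> t <= b -> f t = f a.
Proof.
move=> acf df t at_ tb; apply/eqP; rewrite eq_le; apply/andP; split.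
  rewrite -lerN2.
  apply: (@ac_nondecreasing_deriv _ a b (fun x => - f x)) => //.
    exact: ac_opp.
  move: df; apply: lebesgue_aeS => r dr ar rb; exists 0 => //.
  by rewrite -oppr0; apply: is_deriveN; exact: dr.
apply: (@ac_nondecreasing_deriv _ a b f) => //.
by move: df; apply: lebesgue_aeS => r dr ar rb; exists 0 => //; exact: dr.
Qed.

(** Both sides are measures in [A], and they agree on intervals. *)
Lemma lebesgue_measure_reflect (R : realType) (c : R) (A : set R) :
  measurable A ->
  pushforward (@lebesgue_measure R)
    ((fun t => c - t) : _ -> measurableTypeR R) A = lebesgue_measure A.
Proof.
move=> mA; apply/esym/lebesgue_measure_unique => //= [|_ _ [[a b]] _ <-].
  by apply: measurable_funB => //; exact: measurable_cst.
rewrite /pushforward (_ : _ @^-1` _ = `[c - b, c - a[%classic); last first.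
  by apply/seteqP; split=> t /=; rewrite !in_itv /=; lra.
rewrite !lebesgue_measure_itv /= !lte_fin ltrD2l ltrN2.
by case: ifP => // _; rewrite -!EFinB; congr EFin; ring.
Qed.

Lemma ae_reflect (R : realType) (c : R) (P : R -> Prop) :
  {ae @lebesgue_measure R, forall t, P t} ->
  {ae @lebesgue_measure R, forall t, P (c - t)}.
Proof.
move=> [A [mA A0 PA]]; exists [set t | A (c - t)]; split.
- have mf : measurable_fun [set: R] (fun t : R => c - t).
    by apply: measurable_funB => //; exact: measurable_cst.
  by have := mf measurableT A mA; rewrite setTI.
- by rewrite -[RHS]A0 -(lebesgue_measure_reflect c mA).
- by move=> t /= nP; apply: PA.
Qed.

(** The last zero is the supremum of the times at which [y] is
nonpositive. *)
Lemma last_zero (R : realType) (y : R -> R) (a b : R) :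
  absolutely_continuous_on a b y -> a <= b -> y a = 0 -> 0 < y b ->
  exists s, [/\ a <= s, s < b, y s = 0 & forall r, s < r -> r <= b -> 0 < y r].
Proof.
move=> acy ab ya yb.
pose S := [set r | [/\ a <= r, r <= b & y r <= 0]].
have Sa : S a by split; rewrite ?lexx ?ya.
have ubS : ubound S b by move=> r [].
have hS : has_sup S by split; [exists a|exists b].
have as_ : a <= sup S by apply: ub_le_sup => //; exists b.
have sb : sup S <= b by apply: ge_sup => //; exists a.
have pos r : sup S < r -> r <= b -> 0 < y r.
  move=> sr rb; rewrite ltNge; apply/negP => yr.
  have : r <= sup S by apply: ub_le_sup; [exists b|split => //; lra].
  lra.
have ys0 : y (sup S) <= 0.
  rewrite leNgt; apply/negP => ys.
  have [d d0 hd] := ac_dist acy ys.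
  have [r Sr dr] := sup_adherent d0 hS.
  have rs : r <= sup S by apply: ub_le_sup => //; exists b.
  have [ar rb yr] := Sr.
  have : `|y (sup S) - y r| < y (sup S).
    by apply: hd => //; rewrite ger0_norm; lra.
  by rewrite ltr_norml; lra.
have sltb : sup S < b.
  by rewrite lt_neqAle sb andbT; apply/eqP => e; move: ys0; rewrite e; lra.
exists (sup S); split => //; apply/eqP; rewrite eq_le ys0 /= leNgt; apply/negP => ys.
have ysN : 0 < - y (sup S) by lra.
have [d d0 hd] := ac_dist acy ysN.
have [r [sr rb rd]] : exists r, [/\ sup S < r, r <= b & r < sup S + d].
  move: (sup S) sltb => c cb.
  by have [?|?] := leP (c + d / 2) b; [exists (c + d / 2)|exists b]; split; lra.
have : `|y r - y (sup S)| < - y (sup S).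
  by apply: hd => //; [lra|rewrite gtr0_norm; lra].
have := pos r sr rb; rewrite ltr_norml; lra.
Qed.

Lemma ac_growth (R : realType) (y : R -> R) (a b c : R) :
  absolutely_continuous_on a b y -> y a = 0 -> 0 < c ->
  {ae @lebesgue_measure R, forall t, a < t -> t < b ->
    exists2 l, c <= l & is_derive t 1 y l} ->
  forall t, a < t -> t <= b -> 0 < y t.
Proof.
move=> acy ya c0 dy t at_ tb.
suff : y a + - c * a <= y t + - c * t by rewrite ya; nra.
apply: (ac_nondecreasing_deriv (f := fun t => y t + - c * t) (a := a) (b := b)) => //; last exact: ltW.
  by apply: ac_add => //; apply: ac_mul; [exact: ac_cst|exact: ac_id].
move: dy; apply: lebesgue_aeS => r dr ar rb; have [l cl yl] := dr ar rb.
exists (l - c); first by rewrite subr_ge0.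
by apply: is_derive_eq; rewrite /GRing.scale /=; ring.
Qed.

(** * Plane vectors *)

Lemma dotE (R : realType) (u v : 'rV[R]_2) :
  dot u v = u 0 0 * v 0 0 + u 0 1 * v 0 1.
Proof.
by rewrite /dot !big_ord_recl big_ord0 addr0 (_ : lift ord0 ord0 = 1) //; exact: val_inj.
Qed.

Lemma rowE2 (R : realType) (v w : 'rV[R]_2) :
  v 0 0 = w 0 0 -> v 0 1 = w 0 1 -> v = w.
Proof.
move=> v0 v1; apply/rowP => j; have : (j < 2)%N by [].
rewrite ltnS leq_eqVlt ltnS leqn0 => /orP[] /eqP j01.
  by rewrite (_ : j = 1) //; exact: val_inj.
by rewrite (_ : j = 0) //; exact: val_inj.
Qed.

Lemma dot_self_gt0 (R : realType) (v : 'rV[R]_2) : v != 0 -> 0 < dot v v.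
Proof.
move=> v0; rewrite dotE lt_neqAle addr_ge0 -?expr2 ?sqr_ge0 // andbT eq_sym.
rewrite paddr_eq0 ?sqr_ge0 // !sqrf_eq0; apply: contra v0 => /andP[/eqP e0 /eqP e1].
by apply/eqP/rowE2; rewrite ?e0 ?e1 mxE.
Qed.

Lemma dotZr (R : realType) (s : R) (h w : 'rV[R]_2) : dot h (s *: w) = s * dot h w.
Proof. by rewrite !dotE !mxE; ring. Qed.

Lemma dot_sumr (R : realType) (m : nat) (h : 'rV[R]_2) (c : 'I_m -> R)
    (v : 'I_m -> 'rV[R]_2) :
  dot h (\sum_i c i *: v i) = \sum_i c i * dot h (v i).
Proof.
rewrite dotE !summxE !mulr_sumr -big_split /=; apply: eq_bigr => i _.
by rewrite !mxE dotE; ring.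
Qed.

(** The quarter turn; [dot (rot90 u) v] is the determinant of [(u, v)]. *)
Definition rot90 (R : realType) (v : 'rV[R]_2) : 'rV[R]_2 :=
  \row_j [:: - v 0 1; v 0 0]`_j.

Lemma dot_rot90 (R : realType) (u v : 'rV[R]_2) :
  dot (rot90 u) v = u 0 0 * v 0 1 - u 0 1 * v 0 0.
Proof. by rewrite dotE !mxE /=; ring. Qed.

(** * Faces and edges of a convex polygon *)

(** The face of [Omega] exposed by the covector [h]: a vertex or an edge if
[Omega] is a polygon with interior points and [h] is nonzero. *)
Definition face (R : realType) (Omega : set 'rV[R]_2) (h : 'rV[R]_2) :=
  [set w | Omega w /\ forall v, Omega v -> dot h v <= dot h w].

Definition support_fun (R : realType) (Omega : set 'rV[R]_2) (h : 'rV[R]_2) : R :=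
  sup [set dot h v | v in Omega].

Lemma support_face (R : realType) (Omega : set 'rV[R]_2) (h w : 'rV[R]_2) :
  face Omega h w -> support_fun Omega h = dot h w.
Proof.
move=> [Ow hw]; apply/eqP; rewrite eq_le; apply/andP; split.
  by apply: ge_sup => [|_ [v Ov <-]]; [exists (dot h w), w|exact: hw].
by apply: ub_le_sup; [exists (dot h w) => _ [v Ov <-]; exact: hw|exists w].
Qed.

Lemma hull_vertex (R : realType) (m : nat) (v : 'I_m -> 'rV[R]_2) (i : 'I_m) :
  convex_hull v (v i).
Proof.
exists (fun j => (j == i)%:R); split=> [j||]; first by rewrite ler0n.
- by rewrite (bigD1 i) //= eqxx big1 ?addr0 // => j /negbTE->.
- rewrite (bigD1 i) //= eqxx scale1r big1 ?addr0 // => j /negbTE->.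
  by rewrite scale0r.
Qed.

Lemma hull_dot_le (R : realType) (m : nat) (v : 'I_m -> 'rV[R]_2)
    (h : 'rV[R]_2) (c : R) :
  (forall i, dot h (v i) <= c) -> forall w, convex_hull v w -> dot h w <= c.
Proof.
move=> hc w [l [l0 l1 ->]]; rewrite dot_sumr.
by rewrite -[leRHS]mul1r -l1 mulr_suml ler_sum // => i _; rewrite ler_wpM2l.
Qed.

(** A linear form on a polygon attains its maximum at a vertex. *)
Lemma polygon_face_nonempty (R : realType) (Omega : set 'rV[R]_2)
    (h : 'rV[R]_2) :
  convex_polygon Omega -> Omega !=set0 -> face Omega h !=set0.
Proof.
move=> [m [v ->]] [z [l [_ l1 _]]].
case: m v l l1 => [|m] v l l1; first by move: l1; rewrite big_ord0; lra.
pose i := [arg max_(i > ord0) dot h (v i)]%O.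
exists (v i); split; first exact: hull_vertex.
apply: hull_dot_le => j.
by rewrite /i; case: arg_maxP => // i' _ h'; exact: h'.
Qed.

Lemma polygon_bounded (R : realType) (Omega : set 'rV[R]_2) :
  convex_polygon Omega -> exists2 C, 0 <= C & forall v, Omega v ->
    `|v 0 0| <= C /\ `|v 0 1| <= C.
Proof.
move=> [m [v ->]]; exists (\sum_i (`|v i 0 0| + `|v i 0 1|)).
  by apply: sumr_ge0 => i _; rewrite addr_ge0.
move=> _ [l [l0 l1 ->]]; rewrite !summxE.
have li1 i : l i <= 1.
  by rewrite -l1 (bigD1 i) //= lerDl sumr_ge0.
split; apply: (le_trans (ler_norm_sum _ _ _)); apply: ler_sum => i _;
  rewrite mxE normrM (ger0_norm (l0 i)); have := l0 i; have := li1 i;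
  have := normr_ge0 (v i 0 0); have := normr_ge0 (v i 0 1); nra.
Qed.

(** A vertex that is not exposed by [h] misses the maximum by at least a
fixed gap, there being finitely many of them, so it cannot become exposed by a
covector close to [h]. *)
Lemma polygon_face_usc (R : realType) (Omega : set 'rV[R]_2) (h : 'rV[R]_2) :
  convex_polygon Omega -> exists2 d, 0 < d &
    forall g : 'rV[R]_2, `|g 0 0 - h 0 0| < d -> `|g 0 1 - h 0 1| < d ->
      face Omega g `<=` face Omega h.
Proof.
move=> pO; have [C C0 hC] := polygon_bounded pO.
move: pO => [m [v Ov]].
have [neO|nO] := pselect (Omega !=set0); last first.
  by exists 1 => // g _ _ w [Ow _]; case: nO; exists w.
have [w0 fw0] := polygon_face_nonempty h (ex_intro _ m (ex_intro _ v Ov)) neO.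
pose H := dot h w0.
have [gap gap0 hgap] : exists2 e, 0 < e & forall i, dot h (v i) < H ->
    dot h (v i) <= H - e.
  exists (\big[Num.min/1]_(i | dot h (v i) < H) (H - dot h (v i))).
    by apply: lt_bigmin => // i; rewrite subr_gt0.
  move=> i hi; rewrite lerBrDr addrC -lerBrDr; exact: bigmin_le_cond.
(* Each value of a form on [Omega] moves by at most [2 C d], so the
   difference of two values moves by less than [gap]. *)
pose d := gap / (4 * C + 1).
have C1 : 0 < 4 * C + 1 by lra.
exists d; first exact: divr_gt0.
move=> g g0 g1 w [Ow gw].
have dgap : 4 * C * d < gap.
  have d0 : 0 < d by exact: divr_gt0.
  have : d * (4 * C + 1) = gap by rewrite /d divfK ?gt_eqF.
  lra.
have dotd z : Omega z -> `|dot g z - dot h z| <= 2 * C * d.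
  move=> /hC[z0 z1].
  have -> : dot g z - dot h z = (g 0 0 - h 0 0) * z 0 0 + (g 0 1 - h 0 1) * z 0 1.
    by rewrite !dotE; ring.
  apply: (le_trans (ler_normD _ _)); rewrite !normrM.
  have := normr_ge0 (g 0 0 - h 0 0); have := normr_ge0 (g 0 1 - h 0 1).
  have := normr_ge0 (z 0 0); have := normr_ge0 (z 0 1).
  nra.
split=> // z Oz; apply: (le_trans (proj2 fw0 z Oz)); rewrite -/H.
have := Ow; rewrite {1}Ov => -[l [l0 l1 wE]].
have gvi i : dot g (v i) <= dot g w.
  by apply: gw; rewrite Ov; exact: hull_vertex.
have lact i : l i != 0 -> dot g (v i) = dot g w.
  move=> li0; apply/eqP; rewrite eq_le gvi /=.
  have : \sum_j l j * (dot g w - dot g (v j)) = 0.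
    under eq_bigr do rewrite mulrBr.
    by rewrite sumrB -mulr_suml l1 mul1r wE dot_sumr subrr.
  move=> /eqP; rewrite psumr_eq0; last first.
    by move=> j _; rewrite mulr_ge0 ?subr_ge0.
  move=> /allP /(_ i); rewrite mem_index_enum => /(_ isT) /=.
  by rewrite mulf_eq0 (negbTE li0) /= subr_eq0 => /eqP->.
rewrite {1}wE dot_sumr -[leLHS]mul1r -l1 mulr_suml; apply: ler_sum => i _.
have [->|li0] := eqVneq (l i) 0; first by rewrite !mul0r.
rewrite ler_wpM2l // leNgt; apply/negP => /hgap hi.
have Ovi : Omega (v i) by rewrite Ov; exact: hull_vertex.
have := dotd _ Ovi; have := dotd _ (proj1 fw0); have := gw _ (proj1 fw0).
rewrite (lact i li0) !ler_norml -/H => ? /andP[? ?] /andP[? ?].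
have : dot g (v i) = dot g w by exact: lact.
lra.
Qed.

Lemma support_lipschitz (R : realType) (Omega : set 'rV[R]_2) :
  convex_polygon Omega -> Omega !=set0 -> exists2 C, 0 <= C &
  forall g h, `|support_fun Omega g - support_fun Omega h| <=
    C * `|g 0 0 - h 0 0| + C * `|g 0 1 - h 0 1|.
Proof.
move=> pO O0; have [C C0 hC] := polygon_bounded pO; exists C => //.
suff H g h : support_fun Omega g - support_fun Omega h <=
    C * `|g 0 0 - h 0 0| + C * `|g 0 1 - h 0 1|.
  move=> g h; rewrite ler_norml H andbT lerNl opprB (le_trans (H h g)) //.
  by rewrite !(distrC (h _ _)).
have [w fw] := polygon_face_nonempty g pO O0.
have [z fz] := polygon_face_nonempty h pO O0.
rewrite (support_face fw) (support_face fz).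
have /hC[w0 w1] := proj1 fw.
have : dot h w <= dot h z by apply: (proj2 fz); exact: (proj1 fw).
have : dot g w - dot h w <= C * `|g 0 0 - h 0 0| + C * `|g 0 1 - h 0 1|.
  have -> : dot g w - dot h w = (g 0 0 - h 0 0) * w 0 0 + (g 0 1 - h 0 1) * w 0 1.
    by rewrite !dotE; ring.
  apply: (le_trans (ler_norm _)); apply: (le_trans (ler_normD _ _)).
  by rewrite !normrM !(mulrC C) lerD // ler_wpM2l.
lra.
Qed.

(** Fix the value [H] of the form [h0].  On that line the forms [g] and [g']
depend only on the coordinate along [rot90 h0], with slopes of the same sign,
so their maximizers [w] and [w'] push that coordinate to the same end. *)
Lemma face_same_side (R : realType) (Omega : set 'rV[R]_2) (H : R)
    (h0 g g' w w' : 'rV[R]_2) :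
  H != 0 ->
  dot h0 w = H -> dot h0 w' = H ->
  face Omega g w -> face Omega g' w' ->
  0 < dot (rot90 h0) g * dot (rot90 h0) g' -> w = w'.
Proof.
move=> H0 hw hw' [Ow fw] [Ow' fw'] yy.
have n0 : 0 < dot h0 h0.
  apply: dot_self_gt0; apply: contra_neq H0 => h00.
  by rewrite -hw h00 dotE !mxE !mul0r addr0.
have split2 (f v : 'rV[R]_2) : dot h0 h0 * dot f v =
    dot h0 f * dot h0 v + dot (rot90 h0) f * dot (rot90 h0) v.
  by rewrite !dot_rot90 !dotE; ring.
have le1 : dot (rot90 h0) g * (dot (rot90 h0) w' - dot (rot90 h0) w) <= 0.
  have := fw _ Ow'; rewrite -(ler_pM2l n0) !split2 hw hw'; lra.
have le2 : dot (rot90 h0) g' * (dot (rot90 h0) w - dot (rot90 h0) w') <= 0.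
  have := fw' _ Ow; rewrite -(ler_pM2l n0) !split2 hw hw'; lra.
have ww : dot (rot90 h0) w = dot (rot90 h0) w'.
  move: yy le1 le2; set y := dot _ g; set y' := dot _ g'.
  set z := dot _ w; set z' := dot _ w' => yy le1 le2.
  apply/eqP; rewrite -subr_eq0 -sqrf_eq0 eq_le sqr_ge0 andbT.
  by rewrite -(pmulr_rle0 _ yy); nra.
have coord0 (v : 'rV[R]_2) : dot h0 h0 * v 0 0 = h0 0 0 * dot h0 v - h0 0 1 * dot (rot90 h0) v.
  by rewrite dot_rot90 !dotE; ring.
have coord1 (v : 'rV[R]_2) : dot h0 h0 * v 0 1 = h0 0 1 * dot h0 v + h0 0 0 * dot (rot90 h0) v.
  by rewrite dot_rot90 !dotE; ring.
have e0 : dot h0 h0 * w 0 0 = dot h0 h0 * w' 0 0 by rewrite !coord0 hw hw' ww.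
have e1 : dot h0 h0 * w 0 1 = dot h0 h0 * w' 0 1 by rewrite !coord1 hw hw' ww.
have nn0 : dot h0 h0 != 0 by rewrite gt_eqF.
by apply: rowE2; [exact: (mulfI nn0 e0)|exact: (mulfI nn0 e1)].
Qed.

Lemma interior0_scale (R : realType) (Omega : set 'rV[R]_2) (w : 'rV[R]_2) :
  interior Omega 0 -> exists2 s, 0 < s & Omega (s *: w).
Proof.
move=> /nbhs_norm0P[e /= e0 eO].
have w0 : 0 < `|w| + 1 by rewrite ltr_wpDl.
have s0 : 0 < e / (`|w| + 1) by exact: divr_gt0.
exists (e / (`|w| + 1)) => //; apply: eO => /=.
by rewrite normrZ (gtr0_norm s0) mulrAC ltr_pdivrMr // ltr_pM2l // ltrDl.
Qed.

Lemma support_gt0 (R : realType) (Omega : set 'rV[R]_2) (h : 'rV[R]_2) :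
  convex_polygon Omega -> interior Omega 0 -> h != 0 -> 0 < support_fun Omega h.
Proof.
move=> pO iO h0; have [s s0 Os] := interior0_scale h iO.
have [w fw] := polygon_face_nonempty h pO (ex_intro _ _ Os).
rewrite (support_face fw); apply: lt_le_trans (proj2 fw _ Os).
by rewrite dotZr mulr_gt0 // dot_self_gt0.
Qed.

(** Turn [h] towards [K], until for the first time a vertex other than
[v0] becomes a maximizer too; [ratio l] is the slope at which vertex [l]
catches up with [v0].  The turned covector is nonzero because its component
along [h] has not changed. *)
Lemma turn_to_edge (R : realType) (m : nat) (v : 'I_m -> 'rV[R]_2)
    (h K v0 : 'rV[R]_2) (i : 'I_m) :
  face (convex_hull v) h v0 -> dot h K = 0 -> h != 0 ->
  dot K v0 < dot K (v i) ->
  exists2 E, polygon_edge (convex_hull v) E & E v0.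
Proof.
move=> [Ov0 fv0] hK h0 iK.
pose ratio j := (dot h v0 - dot h (v j)) / (dot K (v j) - dot K v0).
pose j := [arg min_(j < i | dot K v0 < dot K (v j)) ratio j]%O.
have [jK jmin] : dot K v0 < dot K (v j) /\
    forall l, dot K v0 < dot K (v l) -> ratio j <= ratio l.
  by rewrite /j; case: arg_minP => // l lK hl; split => // *; exact: hl.
have hv l : dot h (v l) <= dot h v0 by apply: fv0; exact: hull_vertex.
have s0 : 0 <= ratio j by rewrite divr_ge0 // subr_ge0 // ltW.
have sj : ratio j * (dot K (v j) - dot K v0) = dot h v0 - dot h (v j).
  by rewrite /ratio divfK // gt_eqF // subr_gt0.
pose c := h + ratio j *: K.
have cE w : dot c w = dot h w + ratio j * dot K w.
  by rewrite !dotE !mxE; ring.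
have fc w : face (convex_hull v) c w <-> convex_hull v w /\ dot c w = dot c v0.
  have cv l : dot c (v l) <= dot c v0.
    rewrite !cE; have [lK|lK] := ltP (dot K v0) (dot K (v l)); last first.
      by have := hv l; nra.
    have : ratio j * (dot K (v l) - dot K v0) <= dot h v0 - dot h (v l).
      by rewrite -ler_pdivlMr ?subr_gt0 //; exact: jmin.
    lra.
  have cO := hull_dot_le cv.
  split=> [[Ow fw]|[Ow ew]]; split => //; last by move=> z Oz; rewrite ew; exact: cO.
  by apply/eqP; rewrite eq_le cO //= fw.
exists (face (convex_hull v) c); last by apply/fc.
exists c.
  apply: contraTneq (dot_self_gt0 h0) => c0.
  have : dot c h = 0 by rewrite c0 dotE !mxE; ring.
  rewrite cE (_ : dot K h = 0); last by rewrite -hK !dotE; ring.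
  by rewrite mulr0 addr0 => ->; rewrite ltxx.
split => //; exists v0, (v j); split.
- by apply/fc.
- by apply/fc; split; [exact: hull_vertex|rewrite !cE; lra].
- by apply: contraTneq jK => <-; rewrite ltxx.
Qed.

(** A face with two points is an edge.  A single exposed point is a vertex,
and one can turn about it in at least one direction, since otherwise
[rot90 h] would be constant on [Omega], which has 0 in its interior. *)
Lemma face_in_edge (R : realType) (Omega : set 'rV[R]_2) (h : 'rV[R]_2) :
  convex_polygon Omega -> interior Omega 0 -> h != 0 ->
  exists2 E, polygon_edge Omega E & face Omega h `<=` E.
Proof.
move=> pO iO h0.
have [[a [b [fa fb ab]]]|single] :=
  pselect (exists a b, [/\ face Omega h a, face Omega h b & a != b]).
  by exists (face Omega h) => //; exists h => //; split => //; exists a, b.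
have O0 : Omega 0 by exact: interior_subset.
have [v0 fv0] := polygon_face_nonempty h pO (ex_intro _ _ O0).
suff [E edge Ev0] : exists2 E, polygon_edge Omega E & E v0.
  exists E => // w fw; suff -> : w = v0 by [].
  by apply/eqP/negPn/negP => wv0; apply: single; exists w, v0.
have [s s0 Os] := interior0_scale (rot90 h) iO.
move: pO => [m [v Ov]].
have hrot : dot h (rot90 h) = 0 by rewrite dotE !mxE /=; ring.
have hrotN : dot h (- rot90 h) = 0 by rewrite dotE !mxE /=; ring.
have dN w : dot (- rot90 h) w = - dot (rot90 h) w by rewrite !dotE !mxE /=; ring.
have [[i hi]|none] := pselect (exists i, dot (rot90 h) v0 < dot (rot90 h) (v i)).
  by rewrite Ov; apply: (turn_to_edge _ hrot h0 hi); rewrite -Ov.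
have [[i hi]|noneN] := pselect (exists i, dot (- rot90 h) v0 < dot (- rot90 h) (v i)).
  by rewrite Ov; apply: (turn_to_edge _ hrotN h0 hi); rewrite -Ov.
have up w : Omega w -> dot (rot90 h) w <= dot (rot90 h) v0.
  rewrite Ov; apply: hull_dot_le => i; rewrite leNgt; apply/negP => hi.
  by apply: none; exists i.
have down w : Omega w -> dot (- rot90 h) w <= dot (- rot90 h) v0.
  rewrite Ov; apply: hull_dot_le => i; rewrite leNgt; apply/negP => hi.
  by apply: noneN; exists i.
have : 0 < dot (rot90 h) (s *: rot90 h).
  rewrite dotZr mulr_gt0 // (_ : dot _ _ = dot h h) ?dot_self_gt0 //.
  by rewrite !dotE !mxE /=; ring.
have d0 : dot (rot90 h) 0 = 0 by rewrite dotE !mxE !mulr0 addr0.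
have := up _ Os; have := down _ O0; rewrite !dN d0; lra.
Qed.

(** * Rotation flows and their first integrals *)

(** The planar system obeyed by the switching covector [h] of an extremal:
[h' = k J u], [k' = <b, u>] with [J] the quarter turn, and [u] maximizes
[<h, .>] over [Omega]. *)
Record rotation_flow (R : realType) (Omega : set 'rV[R]_2) (b : 'rV[R]_2)
    (T : R) (h : R -> 'rV[R]_2) (k : R -> R) (u : R -> 'rV[R]_2) : Prop :=
  RotationFlow {
  flow_h1_ac : absolutely_continuous_on 0 T (fun t => h t 0 0) ;
  flow_h2_ac : absolutely_continuous_on 0 T (fun t => h t 0 1) ;
  flow_k_ac : absolutely_continuous_on 0 T k ;
  flow_ode : {ae @lebesgue_measure R, forall t, 0 < t -> t < T ->
    [/\ is_derive t 1 (fun s => h s 0 0) (- (k t * u t 0 1)),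
        is_derive t 1 (fun s => h s 0 1) (k t * u t 0 0),
        is_derive t 1 k (dot b (u t)) & face Omega (h t) (u t)]}
}.

(** Reversing time changes the sign of [h'], which [- k] restores, and leaves
[k' = <b, u>] alone since both [k] and the time change sign. *)
Lemma rotation_flow_reverse (R : realType) (Omega : set 'rV[R]_2)
    (b : 'rV[R]_2) (T : R) (h : R -> 'rV[R]_2) (k : R -> R) (u : R -> 'rV[R]_2) :
  rotation_flow Omega b T h k u ->
  rotation_flow Omega b T (fun t => h (T - t)) (fun t => - k (T - t))
    (fun t => u (T - t)).
Proof.
move=> [ac1 ac2 ack ode]; split.
- exact: (ac_reflect ac1).
- exact: (ac_reflect ac2).
- exact: ac_opp (ac_reflect ack).
- move: (ae_reflect T ode); apply: lebesgue_aeS => t ht t0 tT.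
  have [||d1 d2 dk fu] := ht; [lra|lra|split => //].
  + by rewrite mulNr; exact: (is_derive_reflect d1).
  + by rewrite mulNr; exact: (is_derive_reflect d2).
  + by rewrite -[X in is_derive _ _ _ X]opprK; apply: is_deriveN; exact: is_derive_reflect.
Qed.

(** The support function at [h s] is at least [<h s, u t>], whose derivative
in [s] at [s = t] is [k t * <J u t, u t> = 0].  This bounds its lower right
derivative only; the opposite inequality is obtained by reversing time. *)
Lemma support_flow_nondecreasing (R : realType) (Omega : set 'rV[R]_2)
    (b : 'rV[R]_2) (T : R) (h : R -> 'rV[R]_2) (k : R -> R) (u : R -> 'rV[R]_2) :
  convex_polygon Omega -> Omega !=set0 -> rotation_flow Omega b T h k u ->
  forall s t, 0 <= s -> s <= t -> t <= T ->
  support_fun Omega (h s) <= support_fun Omega (h t).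
Proof.
move=> pO neO [ac1 ac2 ack ode] s t s0 st tT.
have [C C0 lipC] := support_lipschitz pO neO.
apply: (ac_nondecreasing (f := fun t => support_fun Omega (h t))) => //.
  by apply: (ac_dominated2 (ac_sub s0 tT ac1) (ac_sub s0 tT ac2) C0 C0) => *.
move: ode; apply: lebesgue_aeS => r hr sr rt e e0.
have [||d1 d2 _ fu] := hr; [lra|lra|].
pose M := `|u r 0 0| + `|u r 0 1| + 1.
have M0 : 0 < M by rewrite /M ltr_wpDl // addr_ge0.
have eM0 : 0 < e / M by rewrite divr_gt0.
have [d d0 hd1] := is_derive_dist d1 eM0.
have [d' d'0 hd2] := is_derive_dist d2 eM0.
exists (Num.min d d'); first by rewrite lt_min d0.
move=> x rx; rewrite -ltrBlDl lt_min => /andP[xd xd'] _.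
have := hd1 x; have := hd2 x; rewrite (@gtr0_norm _ (x - r)) ?subr_gt0 //.
move=> /(_ xd') /= h2 /(_ xd) /= h1.
have [w fw] := polygon_face_nonempty (h x) pO neO.
rewrite (support_face fw) (support_face fu).
apply: le_trans (proj2 fw _ (proj1 fu)).
set A := h x 0 0 - _ - _ in h1; set B := h x 0 1 - _ - _ in h2.
have -> : dot (h x) (u r) = dot (h r) (u r) + (A * u r 0 0 + B * u r 0 1).
  by rewrite /A /B !dotE; ring.
rewrite lerD2l lerNl.
apply: (le_trans (ler_norm _)); rewrite normrN.
apply: (le_trans (ler_normD _ _)); rewrite !normrM.
have -> : e * (x - r) = e / M * (x - r) * M by field; rewrite gt_eqF.
have : 0 <= e / M * (x - r) by rewrite mulr_ge0 // ?ltW // subr_gt0.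
move: (e / M * (x - r)) h1 h2 => z h1 h2 z0.
rewrite /M; have := normr_ge0 (u r 0 0); have := normr_ge0 (u r 0 1); nra.
Qed.

Lemma support_flow_constant (R : realType) (Omega : set 'rV[R]_2)
    (b : 'rV[R]_2) (T : R) (h : R -> 'rV[R]_2) (k : R -> R) (u : R -> 'rV[R]_2) :
  convex_polygon Omega -> Omega !=set0 -> rotation_flow Omega b T h k u ->
  forall t, 0 <= t -> t <= T -> support_fun Omega (h t) = support_fun Omega (h 0).
Proof.
move=> pO neO flow t t0 tT; apply/eqP; rewrite eq_le; apply/andP; split; last first.
  exact: (support_flow_nondecreasing pO neO flow).
have := support_flow_nondecreasing pO neO (rotation_flow_reverse flow).
move=> /(_ (T - t) T); rewrite subrr opprB addrCA subrr addr0; apply; lra.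
Qed.

(** [k k' = k <b, u> = k <J b, J u> = <J b, h'>]. *)
Lemma energy_flow_constant (R : realType) (Omega : set 'rV[R]_2)
    (b : 'rV[R]_2) (T : R) (h : R -> 'rV[R]_2) (k : R -> R) (u : R -> 'rV[R]_2) :
  rotation_flow Omega b T h k u ->
  forall t, 0 <= t -> t <= T ->
  k t * k t / 2 - dot (rot90 b) (h t) = k 0 * k 0 / 2 - dot (rot90 b) (h 0).
Proof.
move=> [ac1 ac2 ack ode] t t0 tT.
pose E t := k t * k t * 2^-1 + (b 0 1 * h t 0 0 + - b 0 0 * h t 0 1).
suff : E t = E 0 by rewrite /E !dot_rot90; lra.
apply: (ac_constant (b := T)) => //.
  apply: ac_add; first by apply: ac_mul (ac_cst _ _ _); exact: ac_mul.
  by apply: ac_add; apply: ac_mul => //; exact: ac_cst.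
move: ode; apply: lebesgue_aeS => r hr r0 rT; have [d1 d2 dk _] := hr r0 rT.
apply: is_derive_eq.
by rewrite /GRing.scale /= dotE; field.
Qed.

(** * The control is constant on either side of every time *)

(** If [k] were negative at a time where [y > 0], trace back to the last
zero [s] of [y].  On the way the force [B] is nonnegative by the energy
identity, so [k s <= k t < 0], although [k] vanishes wherever [y] does. *)
Lemma pendulum_leaves_rest (R : realType) (y k : R -> R) (a b H B : R) :
  absolutely_continuous_on a b y -> absolutely_continuous_on a b k ->
  0 < H -> y a = 0 ->
  (forall t, a <= t -> t <= b -> 0 < y t -> H * (k t * k t) / 2 = y t * B) ->
  (forall t, a <= t -> t <= b -> y t = 0 -> k t = 0) ->
  {ae @lebesgue_measure R, forall t, a < t -> t < b -> 0 < y t ->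
    is_derive t 1 k B} ->
  forall t, a <= t -> t <= b -> 0 < y t -> 0 <= k t.
Proof.
move=> acy ack H0 ya energy rest dk t at_ tb yt.
rewrite leNgt; apply/negP => kt.
have [s [as_ st ys pos]] := last_zero (ac_sub (lexx a) tb acy) at_ ya yt.
have B0 : 0 <= B.
  rewrite -(pmulr_rge0 _ yt) -energy // divr_ge0 // mulr_ge0 ?(ltW H0) //.
  by rewrite -expr2 sqr_ge0.
have ks : k s = 0 by apply: rest => //; lra.
have : k s <= k t.
  apply: (ac_nondecreasing_deriv (ac_sub as_ tb ack)) => //; last exact: ltW.
  move: dk; apply: lebesgue_aeS => r dr sr rt; exists B => //.
  by apply: dr; [lra|lra|apply: pos; lra].
lra.
Qed.

(** Near [t0] the motion is read off the single coordinate [y], the component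
of [h t] along [rot90 (h t0)]. *)
Section LocalConstancy.
Variables (R : realType) (Omega : set 'rV[R]_2) (b : 'rV[R]_2) (T : R).
Variables (h : R -> 'rV[R]_2) (k : R -> R) (u : R -> 'rV[R]_2).
Hypothesis pO : convex_polygon Omega.
Hypothesis neO : Omega !=set0.
Hypothesis flow : rotation_flow Omega b T h k u.
Hypothesis H_gt0 : 0 < support_fun Omega (h 0).

Let H := support_fun Omega (h 0).

Lemma face_flow t w : 0 <= t -> t <= T -> face Omega (h t) w -> dot (h t) w = H.
Proof.
by move=> t0 tT /support_face <-; exact: (support_flow_constant pO neO flow).
Qed.

Variables (t0 t1 : R).
Hypothesis window : [/\ 0 <= t0, t0 < t1 & t1 <= T].
Hypothesis usc : forall t, t0 <= t -> t <= t1 ->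
  face Omega (h t) `<=` face Omega (h t0).

Let y t := dot (rot90 (h t0)) (h t).

Lemma face_flow0 t w : t0 <= t -> t <= t1 -> face Omega (h t) w ->
  dot (h t0) w = H.
Proof.
have [t0_ge0 t01 t1_le] := window.
move=> tt tt1 fw; apply: face_flow => //; last exact: (usc tt tt1).
by apply: (le_trans (ltW t01)).
Qed.

Lemma offset_ac : absolutely_continuous_on t0 t1 y.
Proof.
have [t0_ge0 t01 t1_le] := window.
have -> : y = fun t => h t0 0 0 * h t 0 1 + - h t0 0 1 * h t 0 0.
  by apply/funext => t; rewrite /y dot_rot90; ring.
by apply: ac_add; apply: ac_mul (ac_cst _ _ _) _; apply: (ac_sub t0_ge0 t1_le);
  [exact: (flow_h2_ac flow)|exact: (flow_h1_ac flow)].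
Qed.

Lemma offset0 : y t0 = 0.
Proof. by rewrite /y dot_rot90; ring. Qed.

(** The factor of [k t] is [<h t0, u t>], which equals [H] because [u t]
belongs to the face exposed by [h t0]. *)
Lemma offset_ode : {ae @lebesgue_measure R, forall t, t0 < t -> t < t1 ->
  [/\ is_derive t 1 y (H * k t), is_derive t 1 k (dot b (u t)) &
      face Omega (h t) (u t)]}.
Proof.
have [t0_ge0 t01 t1_le] := window.
move: (flow_ode flow); apply: lebesgue_aeS => t ht lt0 lt1.
have [||d1 d2 dk fu] := ht; [lra|lra|split => //].
have -> : y = fun t => h t0 0 0 * h t 0 1 + - h t0 0 1 * h t 0 0.
  by apply/funext => r; rewrite /y dot_rot90; ring.
apply: is_derive_eq.
rewrite -(face_flow0 (ltW lt0) (ltW lt1) fu) /GRing.scale /= !dotE; ring.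
Qed.

Lemma same_side_constant t2 : t0 < t2 -> t2 <= t1 ->
  (forall s t, t0 < s -> s < t2 -> t0 < t -> t < t2 -> 0 < y s * y t) ->
  exists c, {ae @lebesgue_measure R, forall t, t0 < t -> t < t2 -> u t = c}.
Proof.
have [t0_ge0 t01 t1_le] := window.
move=> t02 t21 yy; pose s := (t0 + t2) / 2.
have s0 : t0 < s by rewrite /s; lra.
have s2 : s < t2 by rewrite /s; lra.
have [w fw] := polygon_face_nonempty (h s) pO neO.
exists w; move: offset_ode; apply: lebesgue_aeS => t ht lt0 lt2.
have [||_ _ fu] := ht; [lra|lra|].
apply: (@face_same_side _ Omega H (h t0) (h t) (h s)) => //.
- by rewrite gt_eqF.
- by apply: (@face_flow0 t) => //; lra.
- by apply: (@face_flow0 s) => //; lra.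
- exact: yy.
Qed.

(** If [k t0 != 0] then [y] leaves 0 with a speed bounded away from 0. *)
Lemma moving_constant : k t0 != 0 -> exists2 t2, t0 < t2 &
  exists c, {ae @lebesgue_measure R, forall t, t0 < t -> t < t2 -> u t = c}.
Proof.
have [t0_ge0 t01 t1_le] := window.
move=> k0.
have k20 : 0 < `|k t0| / 2 by rewrite divr_gt0 // normr_gt0.
have [d d0 hd] := ac_dist (ac_sub t0_ge0 t1_le (flow_k_ac flow)) k20.
have [t2 [t02 t21 t2d]] : exists t2, [/\ t0 < t2, t2 <= t1 & t2 < t0 + d].
  by have [?|?] := leP t1 (t0 + d / 2); [exists t1|exists (t0 + d / 2)]; split; lra.
exists t2 => //; apply: same_side_constant => //.
have near t : t0 < t -> t < t2 -> `|k t - k t0| < `|k t0| / 2.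
  by move=> *; apply: hd; [lra|lra|lra|lra|rewrite gtr0_norm; lra].
have H0 : 0 < H by [].
have c0 : 0 < H * (`|k t0| / 2) by rewrite mulr_gt0.
have acy := ac_sub (lexx t0) t21 offset_ac.
have [kp|kn] := ltP 0 (k t0).
  suff pos t : t0 < t -> t < t2 -> 0 < y t by move=> s t *; rewrite mulr_gt0 ?pos.
  move=> lt0 /ltW; apply: (ac_growth acy offset0 c0) => //.
  move: offset_ode; apply: lebesgue_aeS => r hr r0 r2.
  have [||dy _ _] := hr; [lra|lra|exists (H * k r) => //].
  by rewrite ler_pM2l // (ger0_norm (ltW kp)); have := near r r0 r2;
     rewrite (ger0_norm (ltW kp)) ltr_norml; lra.
suff neg t : t0 < t -> t < t2 -> 0 < - y t by move=> s t *; rewrite -mulrNN mulr_gt0 ?neg.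
have y0 : - y t0 = 0 by rewrite offset0 oppr0.
move=> lt0 /ltW; apply: (ac_growth (ac_opp acy) y0 c0) => //.
move: offset_ode; apply: lebesgue_aeS => r hr r0 r2.
have [||dy _ _] := hr; [lra|lra|exists (- (H * k r)); last exact: is_deriveN].
by rewrite -mulrN ler_pM2l // (ler0_norm kn); have := near r r0 r2;
     rewrite (ler0_norm kn) ltr_norml; lra.
Qed.

(** Let [d = h t - h t0].  The energy integral gives [k^2 / 2 = <J b, d>];
since [<d, w> = H - H = 0], the vectors [d] and [J w] are parallel, and comparing
them through [h t0] gives [H <J b, d> = y <b, w>]. *)
Lemma rest_energy t w : k t0 = 0 -> t0 <= t -> t <= t1 -> face Omega (h t) w ->
  H * (k t * k t) / 2 = y t * dot b w.
Proof.
have [t0_ge0 t01 t1_le] := window.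
move=> k0 lt0 lt1 fw.
have e : k t * k t / 2 = dot (rot90 b) (h t) - dot (rot90 b) (h t0).
  have := energy_flow_constant flow (t := t); have := energy_flow_constant flow (t := t0).
  rewrite k0 mulr0 mul0r sub0r => -> //; last by lra.
  by move=> e; have := e (le_trans t0_ge0 lt0) (le_trans lt1 t1_le); lra.
have hw := face_flow0 lt0 lt1 fw.
have gw := face_flow (le_trans t0_ge0 lt0) (le_trans lt1 t1_le) fw.
rewrite -mulrA e.
have -> : y t * dot b w = dot (h t0) w * (dot (rot90 b) (h t) - dot (rot90 b) (h t0)) -
    (dot (h t) w - dot (h t0) w) * (b 0 0 * h t0 0 1 - b 0 1 * h t0 0 0).
  by rewrite /y !dot_rot90 !dotE; ring.
by rewrite gw hw subrr mul0r subr0.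
Qed.

Lemma rest_offset0 t : k t0 = 0 -> t0 <= t -> t <= t1 -> y t = 0 -> k t = 0.
Proof.
have [t0_ge0 t01 t1_le] := window.
move=> k0 lt0 lt1 yt; have [w fw] := polygon_face_nonempty (h t) pO neO.
have := rest_energy k0 lt0 lt1 fw; rewrite yt mul0r => /eqP.
by rewrite !mulf_eq0 invr_eq0 pnatr_eq0 orbF gt_eqF //= orbb => /eqP.
Qed.

(** Starting at rest, [k] has the sign of [y]: the flow cannot come back.
The side [y < 0] is the side [y > 0] of the pair [- y, - k]. *)
Lemma rest_outward t : k t0 = 0 -> t0 <= t -> t <= t1 -> 0 <= y t * k t.
Proof.
have [t0_ge0 t01 t1_le] := window.
move=> k0 lt0 lt1; have [w fw] := polygon_face_nonempty (h t) pO neO.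
have acy := offset_ac; have ack := ac_sub t0_ge0 t1_le (flow_k_ac flow).
have samew s v : t0 <= s -> s <= t1 -> face Omega (h s) v -> 0 < y s * y t -> v = w.
  move=> ls0 ls1 fv; apply: (@face_same_side _ Omega H (h t0)) => //.
  - by rewrite gt_eqF.
  - exact: (@face_flow0 s).
  - exact: (@face_flow0 t).
have energyw s : t0 <= s -> s <= t1 -> 0 < y s * y t ->
    H * (k s * k s) / 2 = y s * dot b w.
  move=> ls0 ls1 yy; have [v fv] := polygon_face_nonempty (h s) pO neO.
  by rewrite -(samew s v ls0 ls1 fv yy); exact: rest_energy.
have [yp|yn|<-] := ltgtP 0 (y t); last by rewrite mul0r.
- apply: mulr_ge0; first exact: ltW.
  apply: (pendulum_leaves_rest (B := dot b w) acy ack H_gt0 offset0) => //.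
  + by move=> s ls0 ls1 ys; apply: energyw => //; rewrite mulr_gt0.
  + by move=> s ls0 ls1; exact: rest_offset0.
  + move: offset_ode; apply: lebesgue_aeS => s hs ls0 ls1 ys.
    have [_ dk fu] := hs ls0 ls1.
    by rewrite -(samew s (u s) (ltW ls0) (ltW ls1) fu) // mulr_gt0.
- rewrite -mulrNN; apply: mulr_ge0; first by rewrite oppr_ge0 ltW.
  have y0 : - y t0 = 0 by rewrite offset0 oppr0.
  apply: (pendulum_leaves_rest (B := - dot b w) (ac_opp acy) (ac_opp ack) H_gt0 y0) => //.
  + move=> s ls0 ls1 ys; rewrite !mulrNN; apply: energyw => //.
    by rewrite -mulrNN mulr_gt0 // oppr_gt0.
  + by move=> s ls0 ls1 /eqP; rewrite oppr_eq0 => /eqP ys; rewrite (@rest_offset0 s) ?oppr0.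
  + move: offset_ode; apply: lebesgue_aeS => s hs ls0 ls1 ys.
    have [_ dk fu] := hs ls0 ls1.
    rewrite -(samew s (u s) (ltW ls0) (ltW ls1) fu); first exact: is_deriveN.
    by rewrite -mulrNN mulr_gt0 // oppr_gt0.
  + by rewrite oppr_gt0.
Qed.

(** Where [k] vanishes, so does [<b, u> = k'], hence [u] is a multiple of
[rot90 b], and [<h t0, u> = H] fixes the factor. *)
Lemma stationary_constant t2 : b != 0 -> t0 < t2 -> t2 <= t1 ->
  (forall t, t0 < t -> t < t2 -> k t = 0) ->
  exists c, {ae @lebesgue_measure R, forall t, t0 < t -> t < t2 -> u t = c}.
Proof.
have [t0_ge0 t01 t1_le] := window.
move=> b0 t02 t21 k0; pose D := dot (rot90 b) (h t0).
exists ((H / D) *: rot90 b); move: offset_ode; apply: lebesgue_aeS => t ht lt0 lt2.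
have [||_ dk fu] := ht; [lra|lra|].
have bu := is_derive_locally0 lt0 lt2 k0 dk.
have hu : dot (h t0) (u t) = H by apply: (@face_flow0 t) => //; lra.
have D0 : b 0 0 * H = D * u t 0 1.
  rewrite -hu; apply/eqP; rewrite -subr_eq0; apply/eqP.
  transitivity (h t0 0 0 * dot b (u t)); last by rewrite bu mulr0.
  by rewrite /D dot_rot90 !dotE; ring.
have D1 : b 0 1 * H = - (D * u t 0 0).
  rewrite -hu; apply/eqP; rewrite -subr_eq0; apply/eqP.
  transitivity (h t0 0 1 * dot b (u t)); last by rewrite bu mulr0.
  by rewrite /D dot_rot90 !dotE; ring.
have Hn0 : H != 0 by rewrite gt_eqF.
have Dn0 : D != 0.
  apply: contra_neq b0 => D_0; move: D0 D1; rewrite D_0 !mul0r oppr0.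
  move=> /eqP; rewrite mulf_eq0 (negbTE Hn0) orbF => /eqP b00.
  move=> /eqP; rewrite mulf_eq0 (negbTE Hn0) orbF => /eqP b01.
  by apply: rowE2; rewrite mxE.
apply: rowE2; rewrite !mxE /=; apply: (mulfI Dn0).
  by rewrite -[LHS]opprK -D1; field.
by rewrite -D0; field.
Qed.

(** At rest [y ^+ 2] is nondecreasing, its derivative being [2 H y k].
Either it vanishes up to some later time, or it never vanishes again and [y]
keeps its sign. *)
Lemma local_constancy : b != 0 \/ k t0 != 0 -> exists2 t2, t0 < t2 &
  exists c, {ae @lebesgue_measure R, forall t, t0 < t -> t < t2 -> u t = c}.
Proof.
have [t0_ge0 t01 t1_le] := window.
have [k0 [b0|//]|kn0 _] := eqVneq (k t0) 0; last exact: moving_constant.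
have y2 s t : t0 <= s -> s <= t -> t <= t1 -> y s * y s <= y t * y t.
  apply: (ac_nondecreasing_deriv (f := fun t => y t * y t)).
    by apply: ac_mul; exact: offset_ac.
  move: offset_ode; apply: lebesgue_aeS => r hr r0 r1.
  have [dy _ _] := hr r0 r1; exists (2 * H * (y r * k r)).
    apply: mulr_ge0; last exact: (rest_outward k0 (ltW r0) (ltW r1)).
    by rewrite mulr_ge0 // ltW.
  by apply: is_derive_eq; rewrite /GRing.scale /=; ring.
have [[t2 [t02 t21 yt2]]|ny] := pselect (exists t, [/\ t0 < t, t <= t1 & y t = 0]).
  exists t2 => //; apply: stationary_constant => // t lt0 lt2.
  apply: rest_offset0 => //; [lra|lra|].
  have := y2 t t2 (ltW lt0) (ltW lt2) t21; rewrite yt2 mulr0 => yy.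
  by apply/eqP; rewrite -sqrf_eq0 expr2 eq_le yy -expr2 sqr_ge0.
exists t1 => //; apply: same_side_constant => // s t s0 s1 lt0 lt1.
wlog st : s t s0 s1 lt0 lt1 / s <= t => [wl|].
  by have [st|ts] := leP s t; [apply: wl|rewrite mulrC; apply: wl => //; exact: ltW].
rewrite ltNge; apply/negP => yy.
have acy := ac_sub (ltW s0) (ltW lt1) offset_ac.
have [|r] := IVT (v := 0) st (ac_continuous acy).
  by rewrite ge_min le_max; have [?|?] := leP (y s) 0; have [?|?] := leP (y t) 0 => //=; nra.
rewrite in_itv /= => /andP[sr rt] yr.
by apply: ny; exists r; split => //; lra.
Qed.

End LocalConstancy.

Lemma right_constancy (R : realType) (Omega : set 'rV[R]_2) (b : 'rV[R]_2)
    (T : R) (h : R -> 'rV[R]_2) (k : R -> R) (u : R -> 'rV[R]_2) :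
  convex_polygon Omega -> Omega !=set0 -> rotation_flow Omega b T h k u ->
  0 < support_fun Omega (h 0) -> forall t0, 0 <= t0 -> t0 < T ->
  b != 0 \/ k t0 != 0 -> exists2 t2, t0 < t2 &
  exists c, {ae @lebesgue_measure R, forall t, t0 < t -> t < t2 -> u t = c}.
Proof.
move=> pO neO flow H0 t0 t00 t0T bk.
have [d d0 usc] := polygon_face_usc (h t0) pO.
have [d1 d10 hd1] := ac_dist (flow_h1_ac flow) d0.
have [d2 d20 hd2] := ac_dist (flow_h2_ac flow) d0.
pose e := Num.min (T - t0) (Num.min d1 d2 / 2).
have : 0 < e by rewrite !lt_min subr_gt0 t0T divr_gt0 // lt_min d10.
have : e <= T - t0 by rewrite ge_min lexx.
have : e <= d1 / 2 by rewrite !ge_min ler_pM2r // ge_min lexx orbT.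
have : e <= d2 / 2 by rewrite !ge_min ler_pM2r // ge_min lexx !orbT.
move: e => e e2 e1 eT e0.
apply: (@local_constancy _ Omega b T h k u _ _ _ _ t0 (t0 + e)) => //.
  by split => //; lra.
move=> t lt0 lte; apply: usc.
  by apply: hd1 => //; [lra|lra|lra|rewrite ger0_norm; lra].
by apply: hd2 => //; [lra|lra|lra|rewrite ger0_norm; lra].
Qed.

Lemma left_constancy (R : realType) (Omega : set 'rV[R]_2) (b : 'rV[R]_2)
    (T : R) (h : R -> 'rV[R]_2) (k : R -> R) (u : R -> 'rV[R]_2) :
  convex_polygon Omega -> Omega !=set0 -> rotation_flow Omega b T h k u ->
  0 < support_fun Omega (h 0) -> forall t0, 0 < t0 -> t0 <= T ->
  b != 0 \/ k t0 != 0 -> exists2 t2, t2 < t0 &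
  exists c, {ae @lebesgue_measure R, forall t, t2 < t -> t < t0 -> u t = c}.
Proof.
move=> pO neO flow H0 t0 t00 t0T bk.
have [||||t2 t02 [c uc]] := right_constancy pO neO (rotation_flow_reverse flow) _ (t0 := T - t0).
- by rewrite subr0 (support_flow_constant pO neO flow) // (le_trans (ltW t00)).
- by rewrite subr_ge0.
- lra.
- by rewrite opprB addrCA subrr addr0 oppr_eq0.
exists (T - t2); first lra.
exists c; move: (ae_reflect T uc); apply: lebesgue_aeS => t.
by rewrite opprB addrCA subrr addr0 => ut lt2 lt0; apply: ut; lra.
Qed.

(** * From one-sided constancy to finitely many pieces *)

(** Partitions are extended to the right by right constancy and across limit
times by left constancy. *)
Lemma piecewise_constant_of_local (R : realType) (V : Type) (T : R) (u : R -> V) :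
  0 <= T ->
  (forall t0, 0 <= t0 -> t0 < T -> exists2 t2, t0 < t2 &
    exists c, {ae @lebesgue_measure R, forall t, t0 < t -> t < t2 -> u t = c}) ->
  (forall t0, 0 < t0 -> t0 <= T -> exists2 t2, t2 < t0 &
    exists c, {ae @lebesgue_measure R, forall t, t2 < t -> t < t0 -> u t = c}) ->
  ae_piecewise_constant T u.
Proof.
move=> T0 right left.
have ext s t : s < t ->
    (exists c, {ae @lebesgue_measure R, forall r, s < r -> r < t -> u r = c}) ->
    ae_piecewise_constant s u -> ae_piecewise_constant t u.
  move=> st [c uc] [l pl hl]; exists (l ++ [:: t]).
    by apply: (itv_partition_cat pl); exact: itv_partition1.
  move=> i; rewrite size_cat addn1 ltnS leq_eqVlt => /predU1P[->|il]; last first.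
    rewrite (_ : nth 0 (0 :: l ++ [:: t]) i = nth 0 (0 :: l) i); last first.
      by rewrite -cat_cons nth_cat /= ltnS ltnW.
    by rewrite nth_cat il; exact: hl.
  have -> : nth 0 (0 :: l ++ [:: t]) (size l) = s.
    rewrite -cat_cons nth_cat /= ltnSn nth_last /=.
    by case: pl => _ /eqP.
  have -> : nth 0 (l ++ [:: t]) (size l) = t by rewrite nth_cat ltnn subnn.
  exists c.
  have nst : {ae @lebesgue_measure R, forall r, r <> s /\ r <> t}.
    have n1 a : {ae @lebesgue_measure R, forall r, r <> a}.
      exists [set a]; split => //; first exact: lebesgue_measure_set1.
      by move=> r /= /contrapT.
    by move: (n1 s) (n1 t); apply: lebesgue_aeS2.
  move: uc nst; apply: lebesgue_aeS2 => r ur [rs rt].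
  rewrite in_itv /= => /andP[sr rt']; apply: ur.
    by rewrite lt_neqAle sr andbT eq_sym; apply/eqP.
  by rewrite lt_neqAle rt' andbT; apply/eqP.
apply: (real_induction (a := 0) (b := T) (P := fun t => ae_piecewise_constant t u)) => //.
- by exists [::].
- move=> c c0 cT uc; have [t2 ct2 [v uv]] := right c c0 cT.
  exists t2 => // s cs st2 sT; apply: (ext c) => //; exists v.
  by move: uv; apply: lebesgue_aeS => r ur cr rs; apply: ur => //; exact: lt_trans st2.
- move=> c c0 cT uc; have [t2 t2c [v uv]] := left c c0 cT.
  have [s [s0 sc t2s]] : exists s, [/\ 0 <= s, s < c & t2 <= s].
    by have [?|?] := leP 0 t2; [exists t2|exists 0]; split; lra.
  apply: (ext s) => //; last exact: uc.
  exists v; move: uv; apply: lebesgue_aeS => r ur sr rc; apply: ur => //.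
  exact: le_lt_trans sr.
Qed.

(** * Polynomial primitives *)

Lemma ac_horner (R : realType) (a b : R) (P : {poly R}) :
  absolutely_continuous_on a b (fun t => P.[t]).
Proof.
elim/poly_ind: P => [|P c IH].
  by have -> : (fun t : R => (0 : {poly R}).[t]) = fun=> 0
    by [apply/funext => t; rewrite horner0]; exact: ac_cst.
have -> : (fun t : R => (P * 'X + c%:P).[t]) = fun t => P.[t] * t + c.
  by apply/funext => t; rewrite hornerMXaddC.
by apply: ac_add (ac_cst _ _ _); apply: ac_mul => //; exact: ac_id.
Qed.

Lemma antiderivative (R : realType) (n : nat) (Q : {poly R}) :
  (size Q <= n)%N -> exists2 P : {poly R}, (size P <= n.+1)%N & P^`() = Q.
Proof.
(* The constant coefficient is a quotient by 0, hence 0. *)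
move=> sQ; exists (\poly_(i < n.+1) (Q`_i.-1 / i%:R)); first exact: size_poly.
apply/polyP => i; rewrite coef_deriv coef_poly ltnS.
have [iN|ni] := ltnP i n; last by rewrite mul0rn nth_default // (leq_trans sQ).
by rewrite -[LHS]mulr_natr divfK // pnatr_eq0.
Qed.

Lemma ac_polynomial (R : realType) (a b : R) (n : nat) (Q : {poly R})
    (f : R -> R) :
  (size Q <= n)%N -> absolutely_continuous_on a b f ->
  {ae @lebesgue_measure R, forall t, a < t -> t < b -> is_derive t 1 f Q.[t]} ->
  exists2 P : {poly R}, (size P <= n.+1)%N &
    forall t, a <= t -> t <= b -> f t = P.[t].
Proof.
move=> sQ acf df; have [P sP PQ] := antiderivative sQ.
exists (P + (f a - P.[a])%:P).
  rewrite (leq_trans (size_polyD _ _)) // geq_max sP /=.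
  by rewrite (leq_trans (size_polyC_leq1 _)).
move=> t at_ tb; rewrite hornerD hornerC.
have acP : absolutely_continuous_on a b (fun t => - P.[t]).
  by apply: ac_opp; exact: ac_horner.
have : f t + - P.[t] = f a + - P.[a].
  apply: (ac_constant (f := fun t => f t + - P.[t]) (b := b)) => //.
    exact: ac_add.
  move: df; apply: lebesgue_aeS => r dr ar rb.
  have dP : is_derive r 1 (fun t => P.[t]) Q.[r].
    by rewrite -PQ; exact: is_derive_poly.
  have fr := dr ar rb.
  by apply: is_derive_eq; rewrite subrr.
lra.
Qed.

Lemma quadratic_of_affine (R : realType) (c : 'I_5 -> R) (P1 P2 : {poly R}) :
  (size P1 <= 2)%N -> (size P2 <= 2)%N ->
  exists2 Q : {poly R}, (size Q <= 3)%N & forall t, Q.[t] =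
    c 0 + c 1 * P1.[t] + c 2 * P2.[t] + c 3 * (P1.[t] * P1.[t])
    + c 4 * (P2.[t] * P2.[t]).
Proof.
move=> s1 s2; have sq (q : {poly R}) : (size q <= 2)%N -> (size (q * q)%R <= 3)%N.
  move=> sq; apply: (leq_trans (size_polyMleq _ _)).
  by case: (size q) sq => [|[|[|]]].
exists ((c 0)%:P + c 1 *: P1 + c 2 *: P2 + c 3 *: (P1 * P1) + c 4 *: (P2 * P2)).
  do !(apply: (leq_trans (size_polyD _ _)); rewrite geq_max; apply/andP; split);
    rewrite ?(leq_trans (size_polyC_leq1 _)) //; apply: (leq_trans (size_scale_leq _ _)).
  - exact: leq_trans s1 _.
  - exact: leq_trans s2 _.
  - exact: sq.
  - exact: sq.
by move=> t; rewrite !hornerE.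
Qed.

(** * Extremals as rotation flows *)

(** The norm of a matrix is the largest absolute value of its entries. *)
Lemma norm_coord_le (R : realType) (m n : nat) (M : 'M[R]_(m, n)) i j :
  `|M i j| <= `|M|.
Proof.
rewrite [leRHS]/Num.Def.normr/= mx_normrE.
exact: (le_bigmax _ (fun ij : 'I_m * 'I_n => `|M ij.1 ij.2|) (i, j)).
Qed.

Lemma ac_coord (R : realType) (n : nat) (a b : R) (x : R -> 'rV[R]_n) j :
  absolutely_continuous_on a b x ->
  absolutely_continuous_on a b (fun t => x t 0 j).
Proof.
move=> acx; apply: (ac_dominated acx ler01) => s t _ _ _; rewrite mul1r.
by have := norm_coord_le (x t - x s) 0 j; rewrite !mxE.
Qed.

Lemma is_derive_coord (R : realType) (V : normedModType R) (m n : nat)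
    (M : V -> 'M[R]_(m, n)) (t v : V) (dM : 'M[R]_(m, n)) i j :
  is_derive t v M dM -> is_derive t v (fun s => M s i j) (dM i j).
Proof.
move=> [dv <-]; apply: DeriveDef; first exact: (derivable_mxP M t v).1.
by rewrite derive_mx // mxE.
Qed.

(** The two coordinates are also used on the adjoint vector, where they are
[p1] and [p2]. *)
Definition coord1 (R : realType) (P : subfinsler_case) (x : state_space R P) : R :=
  x 0 ord0.

Definition coord2 (R : realType) (P : subfinsler_case) (x : state_space R P) : R :=
  x 0 (inord 1).

(** The three systems are treated at once as the Cartan system with [r],
[q1], [q2] the adjoint variables that are present, and 0 for the others. *)
Definition costate_r (R : realType) (P : subfinsler_case) :
    state_space R P -> R :=
  match P return state_space R P -> R with
  | Martinet => fun=> 0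
  | Engel => fun p => p 0 2
  | Cartan => fun p => p 0 2
  end.

Definition costate_q1 (R : realType) (P : subfinsler_case) :
    state_space R P -> R :=
  match P return state_space R P -> R with
  | Martinet => fun=> 0
  | Engel => fun=> 0
  | Cartan => fun p => p 0 3
  end.

Definition costate_q2 (R : realType) (P : subfinsler_case) :
    state_space R P -> R :=
  match P return state_space R P -> R with
  | Martinet => fun p => p 0 2
  | Engel => fun p => p 0 3
  | Cartan => fun p => p 0 4
  end.

(** The covector [h] for which the Pontryagin function is [<h, u>].  The
adjoint variables [r], [q1], [q2] are taken from a separate argument [c], so
that along an extremal they can be frozen at their initial values. *)
Definition switching (R : realType) (P : subfinsler_case)
    (c x p : state_space R P) : 'rV[R]_2 := \row_j
  [:: coord1 p - costate_r c / 2 * coord2 x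
        - costate_q2 c / 2 * (coord2 x * coord2 x);
      coord2 p + costate_r c / 2 * coord1 x
        + costate_q1 c / 2 * (coord1 x * coord1 x)]`_j.

Lemma pontryaginE (R : realType) (P : subfinsler_case) (x p : state_space R P)
    (w : 'rV[R]_2) :
  pontryagin x p w = dot (switching p x p) w.
Proof.
have i1 n : inord 1 = 1 :> 'I_n.+2 by apply: val_inj; rewrite /= inordK.
rewrite dotE !mxE /= /coord1 /coord2; case: P x p => x p.
- by rewrite pontryagin_Martinet /= !i1 (_ : ord0 = 0) //; ring.
- by rewrite pontryagin_Engel /= !i1 (_ : ord0 = 0) //; ring.
- by rewrite pontryagin_Cartan /= !i1 (_ : ord0 = 0) //; ring.
Qed.

Lemma h3E (R : realType) (P : subfinsler_case) (x p : state_space R P) :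
  h3 x p = costate_r p + costate_q1 p * coord1 x + costate_q2 p * coord2 x.
Proof.
have i1 n : inord 1 = 1 :> 'I_n.+2 by apply: val_inj; rewrite /= inordK.
rewrite /coord1 /coord2; case: P x p => x p.
- rewrite /h3 /costate_r /costate_q1 /costate_q2 (i1 1) mul0r !add0r //.
- rewrite /h3 /costate_r /costate_q1 /costate_q2 (i1 2) mul0r addr0 addrC //.
- rewrite /h3 /costate_r /costate_q1 /costate_q2 (i1 3) (_ : ord0 = 0) //.
Qed.

Lemma adjoint_q_eq0 (R : realType) (P : subfinsler_case) (p : state_space R P) :
  (adjoint_q p == 0) = (costate_q1 p == 0) && (costate_q2 p == 0).
Proof.
case: P p => p /=; rewrite ?eqxx //.
by rewrite sqrtr_eq0 le_eqVlt ltNge addr_ge0 ?sqr_ge0 //= orbF paddr_eq0 ?sqr_ge0 // !sqrf_eq0.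
Qed.

Lemma pontryagin_partial (R : realType) (P : subfinsler_case)
    (x p : state_space R P) (w : 'rV[R]_2) (i : 'I_(predim P).+1) :
  'D_(delta_mx 0 i) (fun y => pontryagin y p w) x =
  (i == ord0)%:R * ((costate_r p / 2 + costate_q1 p * coord1 x) * w 0 1) -
  (i == inord 1)%:R * ((costate_r p / 2 + costate_q2 p * coord2 x) * w 0 0).
Proof.
have dc j : is_derive x (delta_mx 0 i) (fun y : state_space R P => y 0 j) (j == i)%:R.
  have := is_derive_coord 0 j (is_derive_id x (delta_mx 0 i)).
  by rewrite mxE eqxx.
have d1 : is_derive x (delta_mx 0 i) (@coord1 R P) (ord0 == i)%:R by exact: dc.
have d2 : is_derive x (delta_mx 0 i) (@coord2 R P) (inord 1 == i)%:R by exact: dc.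
have -> : (fun y => pontryagin y p w) = fun y =>
   (coord1 p + - (costate_r p / 2) * coord2 y +
    - (costate_q2 p / 2) * (coord2 y * coord2 y)) * w 0 0 +
   (coord2 p + costate_r p / 2 * coord1 y +
    costate_q1 p / 2 * (coord1 y * coord1 y)) * w 0 1.
  by apply/funext => y; rewrite pontryaginE dotE !mxE /=; ring.
by apply: derive_val; apply: is_derive_eq; rewrite /GRing.scale /= !(eq_sym i); field.
Qed.

(** What the degree bound rests on: the right-hand side has degree 2 in time
once [x1] and [x2] are affine in time. *)
Lemma dynamics_quadratic (R : realType) (P : subfinsler_case) (w : 'rV[R]_2)
    (j : 'I_(predim P).+1) :
  exists c : 'I_5 -> R, forall x : state_space R P, dynamics x w 0 j =
    c 0 + c 1 * coord1 x + c 2 * coord2 x + c 3 * (coord1 x * coord1 x)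
    + c 4 * (coord2 x * coord2 x).
Proof.
have i1 n : inord 1 = 1 :> 'I_n.+2 by apply: val_inj; rewrite /= inordK.
have mk (c0 c1 c2 c3 c4 : R) (f : state_space R P -> R) :
    (forall x, f x = c0 + c1 * coord1 x + c2 * coord2 x
      + c3 * (coord1 x * coord1 x) + c4 * (coord2 x * coord2 x)) ->
  exists c : 'I_5 -> R, forall x : state_space R P, f x =
    c 0 + c 1 * coord1 x + c 2 * coord2 x + c 3 * (coord1 x * coord1 x)
    + c 4 * (coord2 x * coord2 x).
  by move=> fx; exists (fun i : 'I_5 => [:: c0; c1; c2; c3; c4]`_i) => x; rewrite fx.
case: P j mk => -[[|[|[|[|[|//]]]]] //= jP] mk.
- by apply: (mk (w 0 0) 0 0 0 0) => x; rewrite !mxE /=; ring.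
- by apply: (mk (w 0 1) 0 0 0 0) => x; rewrite !mxE /=; ring.
- apply: (mk 0 0 0 0 (- (2^-1 * w 0 0))) => x; rewrite !mxE /= /coord1 /coord2 !i1.
  by rewrite (_ : ord0 = 0) //; ring.
- by apply: (mk (w 0 0) 0 0 0 0) => x; rewrite !mxE /=; ring.
- by apply: (mk (w 0 1) 0 0 0 0) => x; rewrite !mxE /=; ring.
- apply: (mk 0 (2^-1 * w 0 1) (- (2^-1 * w 0 0)) 0 0) => x; rewrite !mxE /= /coord1 /coord2 !i1.
  by rewrite (_ : ord0 = 0) //; ring.
- apply: (mk 0 0 0 0 (- (2^-1 * w 0 0))) => x; rewrite !mxE /= /coord1 /coord2 !i1.
  by rewrite (_ : ord0 = 0) //; ring.
- by apply: (mk (w 0 0) 0 0 0 0) => x; rewrite !mxE /=; ring.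
- by apply: (mk (w 0 1) 0 0 0 0) => x; rewrite !mxE /=; ring.
- apply: (mk 0 (2^-1 * w 0 1) (- (2^-1 * w 0 0)) 0 0) => x; rewrite !mxE /= /coord1 /coord2 !i1.
  by rewrite (_ : ord0 = 0) //; ring.
- apply: (mk 0 0 0 (2^-1 * w 0 1) 0) => x; rewrite !mxE /= /coord1 /coord2 !i1.
  by rewrite (_ : ord0 = 0) //; ring.
- apply: (mk 0 0 0 0 (- (2^-1 * w 0 0))) => x; rewrite !mxE /= /coord1 /coord2 !i1.
  by rewrite (_ : ord0 = 0) //; ring.
Qed.

(** Minus the partial derivative of the Pontryagin function along state
coordinate [i]; it vanishes unless that coordinate is [x1] or [x2]. *)
Definition adjoint_rate (R : realType) (P : subfinsler_case)
    (c x : state_space R P) (w : 'rV[R]_2) (i : 'I_(predim P).+1) : R :=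
  (i == inord 1)%:R * ((costate_r c / 2 + costate_q2 c * coord2 x) * w 0 0) -
  (i == ord0)%:R * ((costate_r c / 2 + costate_q1 c * coord1 x) * w 0 1).

Section Extremal.
Variables (R : realType) (P : subfinsler_case) (Omega : set 'rV[R]_2) (T : R).
Variables (x p : R -> 'rV[R]_(predim P).+1) (u : R -> 'rV[R]_2).
Hypothesis ext : extremal Omega T x p u.

Lemma extremal_coordinates : {ae @lebesgue_measure R, forall t, 0 < t -> t < T ->
  [/\ forall j, is_derive t 1 (fun s => x s 0 j) (dynamics (x t) (u t) 0 j),
      forall j, is_derive t 1 (fun s => p s 0 j) (adjoint_rate (p t) (x t) (u t) j) &
      face Omega (switching (p t) (x t) (p t)) (u t)]}.
Proof.
have dxp : {ae @lebesgue_measure R, forall t, 0 < t -> t < T ->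
  (forall j, is_derive t 1 (fun s => x s 0 j) (dynamics (x t) (u t) 0 j)) /\
  (forall j, is_derive t 1 (fun s => p s 0 j) (adjoint_rate (p t) (x t) (u t) j))}.
  move: (extremal_state_eq ext) (extremal_adjoint_eq ext).
  apply: lebesgue_aeS2 => t dx dp t0 tT.
  have tin : t \in `[0, T] by rewrite in_itv /= !ltW.
  split=> j; first exact: (is_derive_coord 0 j (dx tin)).
  apply: (is_derive_eq (is_derive_coord 0 j (dp tin))).
  by rewrite !mxE pontryagin_partial /adjoint_rate opprB.
move: dxp (extremal_max ext); apply: lebesgue_aeS2 => t dt maxt t0 tT.
have tin : t \in `[0, T] by rewrite in_itv /= !ltW.
have [dx dp] := dt t0 tT; split => //; split.
  exact: (extremal_control_in ext).
by move=> w Ow; rewrite -!pontryaginE; exact: maxt.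
Qed.

Lemma adjoint_coord_constant (j : 'I_(predim P).+1) : (1 < j)%N ->
  forall t, 0 <= t -> t <= T -> p t 0 j = p 0 0 j.
Proof.
move=> j1; apply: (ac_constant (f := fun t => p t 0 j)).
  exact: ac_coord (extremal_adjoint_ac ext).
move: extremal_coordinates; apply: lebesgue_aeS => t ht t0 tT.
have [_ dp _] := ht t0 tT; apply: (is_derive_eq (dp j)).
have jn0 : j == ord0 = false by apply/negbTE; rewrite -val_eqE /= -lt0n ltnW.
have jn1 : j == inord 1 = false.
  apply/negbTE; rewrite -val_eqE /= inordK; last by case: (P).
  by rewrite neq_ltn j1 orbT.
by rewrite /adjoint_rate jn0 jn1 !mul0r subrr.
Qed.
End Extremal.

Lemma costates_constant (R : realType) (P : subfinsler_case)
    (Omega : set 'rV[R]_2) (T : R) (x p : R -> 'rV[R]_(predim P).+1)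
    (u : R -> 'rV[R]_2) :
  extremal Omega T x p u -> forall t, 0 <= t -> t <= T ->
  [/\ costate_r (p t) = costate_r (p 0), costate_q1 (p t) = costate_q1 (p 0) &
      costate_q2 (p t) = costate_q2 (p 0)].
Proof.
move=> ext t t0 tT; have cst := adjoint_coord_constant ext _ t0 tT.
by case: P x p {ext} cst => x p cst; split=> //=; apply: cst.
Qed.

(** The vector [(q1, q2)] that drives [h3]; it vanishes exactly when the
quantity [q] does. *)
Definition gradient (R : realType) (P : subfinsler_case) (p : state_space R P) :
  'rV[R]_2 := \row_j [:: costate_q1 p; costate_q2 p]`_j.

Section ExtremalFlow.
Variables (R : realType) (P : subfinsler_case) (Omega : set 'rV[R]_2) (T : R).
Variables (x p : R -> 'rV[R]_(predim P).+1) (u : R -> 'rV[R]_2).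
Hypothesis ext : extremal Omega T x p u.

Lemma switching_frozen t : 0 <= t -> t <= T ->
  switching (p t) (x t) (p t) = switching (p 0) (x t) (p t).
Proof.
by move=> t0 tT; have [r q1 q2] := costates_constant ext t0 tT; rewrite /switching r q1 q2.
Qed.

Lemma h3_frozen t : 0 <= t -> t <= T -> h3 (x t) (p t) =
  costate_r (p 0) + costate_q1 (p 0) * coord1 (x t)
  + costate_q2 (p 0) * coord2 (x t).
Proof.
by move=> t0 tT; have [r q1 q2] := costates_constant ext t0 tT; rewrite h3E r q1 q2.
Qed.

Lemma dynamics_x1 (y : state_space R P) w : dynamics y w 0 ord0 = w 0 0.
Proof. by case: P y => y /=; rewrite mxE. Qed.

Lemma dynamics_x2 (y : state_space R P) w : dynamics y w 0 (inord 1) = w 0 1.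
Proof. by case: P y => y /=; rewrite mxE inordK. Qed.

(** For [h1] the adjoint equation contributes the factor [r / 2 + q1 x1] and the
corrections in [switching] contribute [r / 2 + q2 x2]; for [h2] the two factors
are exchanged.  Their sum is [h3] in both cases. *)
Lemma extremal_flow : rotation_flow Omega (gradient (p 0)) T
  (fun t => switching (p 0) (x t) (p t))
  (fun t => costate_r (p 0) + costate_q1 (p 0) * coord1 (x t)
    + costate_q2 (p 0) * coord2 (x t))
  u.
Proof.
have acx1 : absolutely_continuous_on 0 T (fun t => coord1 (x t)).
  exact: ac_coord (extremal_state_ac ext).
have acx2 : absolutely_continuous_on 0 T (fun t => coord2 (x t)).
  exact: ac_coord (extremal_state_ac ext).
have acp1 : absolutely_continuous_on 0 T (fun t => coord1 (p t)).
  exact: ac_coord (extremal_adjoint_ac ext).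
have acp2 : absolutely_continuous_on 0 T (fun t => coord2 (p t)).
  exact: ac_coord (extremal_adjoint_ac ext).
have sw1 : (fun t => switching (p 0) (x t) (p t) 0 0) = fun t =>
    coord1 (p t) + - (costate_r (p 0) / 2) * coord2 (x t) +
    - (costate_q2 (p 0) / 2) * (coord2 (x t) * coord2 (x t)).
  by apply/funext => t; rewrite mxE /=; ring.
have sw2 : (fun t => switching (p 0) (x t) (p t) 0 1) = fun t =>
    coord2 (p t) + costate_r (p 0) / 2 * coord1 (x t) +
    costate_q1 (p 0) / 2 * (coord1 (x t) * coord1 (x t)).
  by apply/funext => t; rewrite mxE /=; ring.
have acZ (c : R) (f : R -> R) : absolutely_continuous_on 0 T f ->
    absolutely_continuous_on 0 T (fun t => c * f t) by exact: ac_mul (ac_cst _ _ _).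
split.
- rewrite sw1; apply: ac_add (acZ _ _ _); last exact: ac_mul.
  exact: ac_add (acZ _ _ _).
- rewrite sw2; apply: ac_add (acZ _ _ _); last exact: ac_mul.
  exact: ac_add (acZ _ _ _).
- by apply: ac_add (acZ _ _ _) => //; apply: ac_add (acZ _ _ _) => //; exact: ac_cst.
move: (extremal_coordinates ext); apply: lebesgue_aeS => t ht t0 tT.
have [dx dp fu] := ht t0 tT.
have [r q1 q2] := costates_constant ext (ltW t0) (ltW tT).
have dx1 : is_derive t 1 (fun s => coord1 (x s)) (u t 0 0).
  by apply: (is_derive_eq (dx ord0)); rewrite dynamics_x1.
have dx2 : is_derive t 1 (fun s => coord2 (x s)) (u t 0 1).
  by apply: (is_derive_eq (dx (inord 1))); rewrite dynamics_x2.
have n01 : inord 1 == ord0 :> 'I_(predim P).+1 = false.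
  by rewrite -val_eqE /= inordK //; case: (P).
have dp1 : is_derive t 1 (fun s => coord1 (p s))
    (- ((costate_r (p 0) / 2 + costate_q1 (p 0) * coord1 (x t)) * u t 0 1)).
  apply: (is_derive_eq (dp ord0)).
  by rewrite /adjoint_rate eqxx eq_sym n01 r q1 mul0r sub0r mul1r.
have dp2 : is_derive t 1 (fun s => coord2 (p s))
    ((costate_r (p 0) / 2 + costate_q2 (p 0) * coord2 (x t)) * u t 0 0).
  apply: (is_derive_eq (dp (inord 1))).
  by rewrite /adjoint_rate eqxx n01 r q2 mul0r subr0 mul1r.
rewrite sw1 sw2; split.
- by apply: is_derive_eq; rewrite /GRing.scale /=; field.
- by apply: is_derive_eq; rewrite /GRing.scale /=; field.
- by apply: is_derive_eq; rewrite dotE !mxE /GRing.scale /=; ring.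
- by rewrite -switching_frozen // ltW.
Qed.
End ExtremalFlow.

Lemma max_hamiltonianE (R : realType) (P : subfinsler_case)
    (Omega : set 'rV[R]_2) (x p : state_space R P) :
  max_hamiltonian Omega x p = support_fun Omega (switching p x p).
Proof.
rewrite /max_hamiltonian /support_fun; congr sup; apply/seteqP.
by split=> _ [v Ov <-]; exists v; rewrite ?pontryaginE.
Qed.

(** * Regularity of extremals *)

(** Where the control is constant, [x1] and [x2] are affine, the derivatives
of all state and adjoint variables are quadratic in them, and integration
raises the degree to 3. *)
Lemma extremal_polynomial (R : realType) (P : subfinsler_case)
    (Omega : set 'rV[R]_2) (T : R) (x p : R -> 'rV[R]_(predim P).+1)
    (u : R -> 'rV[R]_2) (w : 'rV[R]_2) (a b : R) :
  extremal Omega T x p u -> 0 <= a -> b <= T ->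
  {ae @lebesgue_measure R, forall t, a < t -> t < b -> u t = w} ->
  forall j, exists2 Q : {poly R}, (size Q <= 4)%N &
    forall t, a <= t -> t <= b -> row_mx (x t) (p t) 0 j = Q.[t].
Proof.
move=> ext a0 bT uw.
have acx j := ac_sub a0 bT (ac_coord j (extremal_state_ac ext)).
have acp j := ac_sub a0 bT (ac_coord j (extremal_adjoint_ac ext)).
have ode : {ae @lebesgue_measure R, forall t, a < t -> t < b ->
  [/\ forall j, is_derive t 1 (fun s => x s 0 j) (dynamics (x t) w 0 j) &
      forall j, is_derive t 1 (fun s => p s 0 j) (adjoint_rate (p 0) (x t) w j)]}.
  move: uw (extremal_coordinates ext); apply: lebesgue_aeS2 => t ut ht at_ tb.
  have [||dx dp _] := ht; [lra|lra|].
  rewrite (ut at_ tb) in dx dp; split => // j; apply: (is_derive_eq (dp j)).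
  have [|//|r q1 q2] := costates_constant ext (t := t); [lra|lra|].
  by rewrite /adjoint_rate r q1 q2.
have [P1 s1 e1] : exists2 Q : {poly R}, (size Q <= 2)%N &
    forall t, a <= t -> t <= b -> coord1 (x t) = Q.[t].
  apply: (ac_polynomial (Q := (w 0 0)%:P)) (acx _) _; first exact: size_polyC_leq1.
  move: ode; apply: lebesgue_aeS => t ht at_ tb; have [dx _] := ht at_ tb.
  by rewrite hornerC -(dynamics_x1 (x t)).
have [P2 s2 e2] : exists2 Q : {poly R}, (size Q <= 2)%N &
    forall t, a <= t -> t <= b -> coord2 (x t) = Q.[t].
  apply: (ac_polynomial (Q := (w 0 1)%:P)) (acx _) _; first exact: size_polyC_leq1.
  move: ode; apply: lebesgue_aeS => t ht at_ tb; have [dx _] := ht at_ tb.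
  by rewrite hornerC -(dynamics_x2 (x t)).
have cubic (f : R -> R) (c : 'I_5 -> R) : absolutely_continuous_on a b f ->
  {ae @lebesgue_measure R, forall t, a < t -> t < b -> is_derive t 1 f
    (c 0 + c 1 * coord1 (x t) + c 2 * coord2 (x t) + c 3 * (coord1 (x t) * coord1 (x t))
     + c 4 * (coord2 (x t) * coord2 (x t)))} ->
  exists2 Q : {poly R}, (size Q <= 4)%N & forall t, a <= t -> t <= b -> f t = Q.[t].
  move=> acf df; have [Q sQ QE] := quadratic_of_affine c s1 s2.
  apply: (ac_polynomial sQ acf); move: df; apply: lebesgue_aeS => t dt at_ tb.
  by rewrite QE -e1 ?ltW // -e2 ?ltW //; exact: dt.
move=> j; have : forall t, row_mx (x t) (p t) 0 j =
    match fintype.split j with inl i => x t 0 i | inr i => p t 0 i end.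
  by move=> t; rewrite mxE.
case: fintype.split => i rowE.
  have [c cE] := dynamics_quadratic w i.
  have [|Q sQ QE] := cubic _ c (acx i); last first.
    by exists Q => // t at_ tb; rewrite rowE QE.
  move: ode; apply: lebesgue_aeS => t ht at_ tb; have [dx _] := ht at_ tb.
  by rewrite -cE.
pose c0 : R := (i == inord 1)%:R; pose c1 : R := (i == ord0)%:R.
pose c (l : 'I_5) : R := [:: c0 * (costate_r (p 0) / 2 * w 0 0) -
   c1 * (costate_r (p 0) / 2 * w 0 1);
   - (c1 * (costate_q1 (p 0) * w 0 1)); c0 * (costate_q2 (p 0) * w 0 0); 0; 0]`_l.
have [|Q sQ QE] := cubic _ c (acp i); last first.
  by exists Q => // t at_ tb; rewrite rowE QE.
move: ode; apply: lebesgue_aeS => t ht at_ tb; have [_ dp] := ht at_ tb.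
by apply: (is_derive_eq (dp i)); rewrite /adjoint_rate /c /= -/c0 -/c1; ring.
Qed.

Lemma piecewise_constant_polynomial (R : realType) (P : subfinsler_case)
    (Omega : set 'rV[R]_2) (T : R) (x p : R -> 'rV[R]_(predim P).+1)
    (u : R -> 'rV[R]_2) :
  extremal Omega T x p u -> ae_piecewise_constant T u ->
  piecewise_polynomial_deg_le 3 T (fun t => row_mx (x t) (p t)).
Proof.
move=> ext [s ps us]; exists s => // i si j; have [c uc] := us i si.
have a0 : 0 <= nth 0 (0 :: s) i.
  rewrite (set_nth_default T) /= ?ltnS 1?ltnW //.
  by apply: (itv_partition_nth_ge _ ps); rewrite ltnS ltnW.
have bT : nth 0 s i <= T.
  rewrite (set_nth_default T) //.
  have si1 : (i.+1 < (size s).+1)%N by [].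
  exact: (itv_partition_nth_le si1 ps).
have uc' : {ae @lebesgue_measure R, forall t,
    nth 0 (0 :: s) i < t -> t < nth 0 s i -> u t = c}.
  move: uc; apply: lebesgue_aeS => t ut at_ tb.
  by apply: ut; rewrite in_itv /= !ltW.
have [Q sQ QE] := extremal_polynomial ext a0 bT uc' j.
by exists Q => // t; rewrite in_itv /= => /andP[at_ tb]; exact: QE.
Qed.

Theorem corollary2 (R : realType) (P : subfinsler_case)
    (Omega : set 'rV[R]_2) (T : R)
    (x p : R -> 'rV[R]_(predim P).+1) (u : R -> 'rV[R]_2)
    (Omega_polygon : convex_polygon Omega)
    (Omega_int : interior Omega 0)
    (T_gt0 : 0 < T)
    (ext : extremal Omega T x p u)
    (H_neq0 : ~ vanishes_on T (fun t => max_hamiltonian Omega (x t) (p t))) :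
  (~ vanishes_on T (fun t => adjoint_q (p t)) \/
   ~ vanishes_on T (fun t => h3 (x t) (p t)) ->
     ae_piecewise_constant T u /\
     piecewise_polynomial_deg_le 3 T (fun t => row_mx (x t) (p t)))
  /\
  (vanishes_on T (fun t => adjoint_q (p t)) /\
   vanishes_on T (fun t => h3 (x t) (p t)) ->
     exists2 E : set 'rV[R]_2, polygon_edge Omega E &
       {ae @lebesgue_measure R, forall t, t \in `[0, T] -> E (u t)}).
Proof.
have neO : Omega !=set0 by exists 0; exact: interior_subset.
pose b := gradient (p 0).
pose h t := switching (p 0) (x t) (p t).
pose k t := costate_r (p 0) + costate_q1 (p 0) * coord1 (x t)
            + costate_q2 (p 0) * coord2 (x t).
have flow : rotation_flow Omega b T h k u := extremal_flow ext.
have h3k t : t \in `[0, T] -> h3 (x t) (p t) = k t.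
  by rewrite in_itv /= => /andP[t0 tT]; exact: (h3_frozen ext).
have qb t : t \in `[0, T] -> (adjoint_q (p t) == 0) = (b == 0).
  rewrite in_itv /= => /andP[t0 tT]; rewrite adjoint_q_eq0.
  have [_ -> ->] := costates_constant ext t0 tT.
  apply/andP/eqP => [[/eqP q1 /eqP q2]|/rowP b0].
    by apply: rowE2; rewrite !mxE.
  by have := b0 0; have := b0 1; rewrite !mxE /= => -> ->.
have H0 : 0 < support_fun Omega (h 0).
  apply: contrapT => nH0; apply: H_neq0 => t; rewrite in_itv /= => /andP[t0 tT].
  have ht0 : h t = 0.
    apply/eqP/negPn/negP => ht; apply: nH0.
    by rewrite -(support_flow_constant Omega_polygon neO flow t0 tT) support_gt0.
  rewrite max_hamiltonianE (switching_frozen ext t0 tT) -/(h t) ht0.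
  have [w fw] := polygon_face_nonempty 0 Omega_polygon neO.
  by rewrite (support_face fw) dotE !mxE !mul0r addr0.
have kcst : b = 0 -> forall t, 0 <= t -> t <= T -> k t = k 0.
  move=> b0; apply: (ac_constant (flow_k_ac flow)).
  move: (flow_ode flow); apply: lebesgue_aeS => t ht t0 tT.
  have [_ _ dk _] := ht t0 tT; apply: (is_derive_eq dk).
  by rewrite b0 dotE !mxE !mul0r addr0.
have zin : (0 : R) \in `[0, T] by rewrite in_itv /= lexx ltW.
split=> [nz|[q0 h30]].
  suff bk t : 0 <= t -> t <= T -> b != 0 \/ k t != 0.
    suff pc : ae_piecewise_constant T u.
      by split => //; exact: piecewise_constant_polynomial ext pc.
    apply: piecewise_constant_of_local; first exact: ltW.
      by move=> t t0 tT; apply: (right_constancy _ _ flow) => //; apply: bk => //; exact: ltW.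
    by move=> t t0 tT; apply: (left_constancy _ _ flow) => //; apply: bk => //; exact: ltW.
  move=> t0 tT; have [b0|] := eqVneq b 0; last by left.
  right; rewrite kcst //; apply/eqP => k00; case: nz; apply=> s sin.
    by apply/eqP; rewrite qb // b0.
  by rewrite h3k //; move: sin; rewrite in_itv /= => /andP[? ?]; rewrite kcst.
have b0 : b = 0 by apply/eqP; rewrite -(qb 0 zin) q0.
have k0 t : 0 <= t -> t <= T -> k t = 0.
  by move=> t0 tT; rewrite -h3k ?h30 // in_itv /= t0.
have hcst t : 0 <= t -> t <= T -> h t = h 0.
  move=> t0 tT; apply: rowE2.
    apply: (ac_constant (flow_h1_ac flow)) t0 tT.
    move: (flow_ode flow); apply: lebesgue_aeS => s hs s0 sT.
    by have [d1 _ _ _] := hs s0 sT; apply: (is_derive_eq d1); rewrite k0 ?ltW // mul0r oppr0.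
  apply: (ac_constant (flow_h2_ac flow)) t0 tT.
  move: (flow_ode flow); apply: lebesgue_aeS => s hs s0 sT.
  by have [_ d2 _ _] := hs s0 sT; apply: (is_derive_eq d2); rewrite k0 ?ltW // mul0r.
have h00 : h 0 != 0.
  apply: contraTneq H0 => ->; have [w fw] := polygon_face_nonempty 0 Omega_polygon neO.
  by rewrite (support_face fw) dotE !mxE !mul0r addr0 ltxx.
have [E edgeE hE] := face_in_edge Omega_polygon Omega_int h00.
exists E => //; move: (extremal_max ext); apply: lebesgue_aeS => t mt tin.
have := tin; rewrite in_itv /= => /andP[t0 tT].
apply: hE; rewrite -(hcst t t0 tT) /h -(switching_frozen ext t0 tT); split.
  exact: (extremal_control_in ext).
by move=> v Ov; rewrite -!pontryaginE; exact: mt.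
Qed.
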